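(* Let $\mathbb{G}$ be a Carnot group and $\varphi$ an Orlicz function with growth exponents $p^-\le p^+$ and $\Delta_2$-constant $\mathbf{C}$. If $u\in\bigcup_{s\in (0,1)}W^{s,\varphi}(\mathbb{G})$, then $$\frac{4}{\mathbf{C}}\frac{QC_b}{p^+}\Phi_\varphi(u)\leq\liminf_{s\downarrow 0}s\,\Phi_{s,\varphi}(u)\leq\limsup_{s\downarrow 0}s\,\Phi_{s,\varphi}(u)\leq\mathbf{C}\,\frac{QC_b}{p^-}\Phi_\varphi(u).$$ In particular, if $\lim_{s\downarrow 0}s\,\Phi_{s,\varphi}(u)$ exists, then $$\frac{4}{\mathbf{C}}\frac{QC_b}{p^+}\Phi_\varphi(u)\leq\lim_{s\downarrow 0}s\,\Phi_{s,\varphi}(u)\leq\mathbf{C}\,\frac{QC_b}{p^-}\Phi_\varphi(u).$$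
   Context: **Carnot group.** $\mathbb{G}=(\mathbb{R}^n,\cdot)$ is a connected, simply connected, nilpotent Lie group whose Lie algebra is stratified: $\mathfrak g=V_1\oplus\cdots\oplus V_k$, $[V_1,V_i]=V_{i+1}$, $V_k\neq\{0\}$, $V_i=\{0\}$ for $i>k$. Points are written in exponential coordinates; $m=\dim V_1$; $Q=\sum_{i=1}^k i\dim V_i$ is the homogeneous dimension; $z=(z',z'')$ with $z'=(z_1,\dots,z_m)$ and $z''=(z_{m+1},\dots,z_n)$. Dilations are $\delta_\lambda(x_1,\dots,x_n)=(\lambda^{d_1}x_1,\dots,\lambda^{d_n}x_n)$, $\lambda>0$, where $d_j$ is the index of the layer to which the $j$-th coordinate belongs. $dx$ is Lebesgue measure on $\mathbb{R}^n$ (a Haar measure of $\mathbb{G}$). **Norm (standing assumptions).** $\|\cdot\|_\mathbb{G}:\mathbb{G}\to[0,\infty)$ is a continuous homogeneous norm: (i) $\|x\|_\mathbb{G}=0$ iff $x=0$; (ii) $\|x^{-1}\|_\mathbb{G}=\|x\|_\mathbb{G}$; (iii) $\|\delta_\lambda x\|_\mathbb{G}=\lambda\|x\|_\mathbb{G}$ for $\lambda>0$; moreover (iv) it is invariant under horizontal rotations, i.e. $\|(Rz',z'')\|_\mathbb{G}=\|(z',z'')\|_\mathbb{G}$ for every rotation $R\in SO(m)$; (v) $\big|\|y\|_\mathbb{G}-\|x\|_\mathbb{G}\big|\le\|y^{-1}\cdot x\|_\mathbb{G}\le\|x\|_\mathbb{G}+\|y\|_\mathbb{G}$ for all $x,y$.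 $C_b$ is the Lebesgue measure of the unit ball $\{x:\|x\|_\mathbb{G}<1\}$. **Orlicz function.** $\varphi(t)=\int_0^t\phi(s)\,ds$ where $\phi:[0,\infty)\to[0,\infty)$ satisfies $\phi(0)=0$, $\phi(t)>0$ for $t>0$, $\phi$ nondecreasing, right-continuous, $\phi(t)\to\infty$ as $t\to\infty$. Standing assumptions on $\varphi$: $\varphi(1)=1$ and there are constants $1<p^-\le p^+<\infty$ with $p^-\le \frac{t\phi(t)}{\varphi(t)}\le p^+$ for all $t>0$. The $\Delta_2$-constant $\mathbf{C}$ is the smallest $C>0$ such that $\varphi(2t)\le C\varphi(t)$ for all $t\ge0$; it satisfies $2<\mathbf{C}\le 2^{p^+}$. **Functionals and spaces.** For measurable $u:\mathbb{G}\to\mathbb{R}$, $\Phi_\varphi(u)=\int_\mathbb{G}\varphi(|u(x)|)\,dx$, and for $0<s<1$ $$\Phi_{s,\varphi}(u)=\iint_{\mathbb{G}\times\mathbb{G}}\varphi\left(\frac{|u(x)-u(y)|}{\|y^{-1}\cdot x\|_\mathbb{G}^s}\right)\frac{dx\,dy}{\|y^{-1}\cdot x\|_\mathbb{G}^Q}.$$ $W^{s,\varphi}(\mathbb{G})$ is the set of measurable $u$ with $\Phi_\varphi(u)<\infty$ and $\Phi_{s,\varphi}(u)<\infty$. *)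

(* Defs.v *)
From HB Require Import structures.
From mathcomp Require Import all_boot all_order all_algebra.
From mathcomp Require Import all_classical all_reals all_analysis.
From mathcomp Require Import measurable_realfun.

Set Implicit Arguments.
Unset Strict Implicit.
Unset Printing Implicit Defensive.
Import Order.TTheory GRing.Theory Num.Theory.
Import numFieldNormedType.Exports.

Local Open Scope classical_set_scope.
Local Open Scope ring_scope.

(** ** Lebesgue measure on [R^n], represented as ['rV[R]_n] *)

Definition measure_rV_display : measure_display.
Proof. exact: default_measure_display. Qed.

Section measurable_rV.
Context {R : realType} (n : nat).

(* The product sigma-algebra, i.e. the Borel sigma-algebra of R^n. *)
Let coors : 'I_n -> 'rV[R]_n -> measurableTypeR R := fun i x => x ord0 i.

Let rV_set0 : g_sigma_preimage coors set0.
Proof. exact: sigma_algebra0. Qed.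

Let rV_setC A : g_sigma_preimage coors A -> g_sigma_preimage coors (~` A).
Proof. exact: sigma_algebraC. Qed.

Let rV_bigcup (F : (set 'rV[R]_n)^nat) :
  (forall i, g_sigma_preimage coors (F i)) ->
  g_sigma_preimage coors (\bigcup_i (F i)).
Proof. exact: sigma_algebra_bigcup. Qed.

HB.instance Definition _ := @isMeasurable.Build measure_rV_display
  'rV[R]_n (g_sigma_preimage coors) rV_set0 rV_setC rV_bigcup.

Lemma measurable_coord (i : 'I_n) :
  measurable_fun [set: 'rV[R]_n] (fun x : 'rV[R]_n => x ord0 i : measurableTypeR R).
Proof.
move=> _ Y mY; rewrite setTI; apply: sub_sigma_algebra => /=.
rewrite -bigcup_seq/=; exists i => /=; first by rewrite mem_index_enum.
by exists Y => //; rewrite setTI.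
Qed.

Lemma measurable_fun_rVP d (T : measurableType d) (f : T -> 'rV[R]_n) :
  (forall i, measurable_fun [set: T] (fun x => f x ord0 i : measurableTypeR R)) ->
  measurable_fun [set: T] f.
Proof.
move=> mf; have H : g_sigma_preimage (fun i => coors i \o f) `<=` measurable.
  apply: smallest_sub; first exact: sigma_algebra_measurable.
  rewrite -bigcup_seq; apply: bigcup_sub => i Ii.
  by move=> A [B mB <-]; exact: mf.
by move=> _ A mA; apply: H; rewrite g_sigma_preimage_comp; exists A.
Qed.

End measurable_rV.

Section rV_measure_cons.
Context {R : realType} (n : nat).
Variable mu : {sigma_finite_measure set ('rV[R]_n) -> \bar R}.

Definition rV_cons (p : (measurableTypeR R * 'rV[R]_n)%type) : 'rV[R]_n.+1 :=
  row_mx (p.1%:M : 'M[R]_1) p.2.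

Lemma measurable_rV_cons : measurable_fun setT rV_cons.
Proof.
apply: measurable_fun_rVP => i.
rewrite /rV_cons; case: (@split_ordP 1 n i) => j ->.
  rewrite [X in measurable_fun _ X](_ : _ = fst); first exact: measurable_fst.
  apply/funext => p; rewrite [LHS]row_mxEl (ord1 j).
  by rewrite mxE eqxx mulr1n.
rewrite [X in measurable_fun _ X](_ : _ =
   (fun x : 'rV[R]_n => x ord0 j : measurableTypeR R) \o snd).
  apply: measurableT_comp; [exact: measurable_coord|exact: measurable_snd].
by apply/funext => p; rewrite [LHS]row_mxEr.
Qed.

(* The measure of A is the integral over t of mu {v | (t, v) \in A}. *)
Definition rV_measure_cons : set 'rV[R]_n.+1 -> \bar R :=
  pushforward (@lebesgue_measure R \x mu)%E rV_cons.

Let pushed : {measure set ('rV[R]_n.+1) -> \bar R} :=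
  measure_function_pushforward__canonical__measure_function_Measure
    (@lebesgue_measure R \x mu)%E measurable_rV_cons.

HB.instance Definition _ := isMeasure.Build _ _ _ rV_measure_cons
  (measure0 pushed) (measure_ge0 pushed)
  (@measure_semi_sigma_additive _ _ _ pushed).

Let rV_measure_cons_sigma_finite : sigma_finite setT rV_measure_cons.
Proof.
have /sigma_finiteP[F [TF ndF Foo]] := sigma_finiteT (@lebesgue_measure R).
have /sigma_finiteP[G [TG ndG Goo]] := sigma_finiteT mu.
pose g (x : 'rV[R]_n.+1) : (measurableTypeR R * 'rV[R]_n)%type :=
  (x ord0 ord0, \row_j x ord0 (lift ord0 j)).
have gK : cancel rV_cons g.
  move=> [t v]; rewrite /g /rV_cons; congr pair.
    rewrite (_ : ord0 = @lshift 1 n ord0); last exact/val_inj.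
    by rewrite [LHS]row_mxEl mxE eqxx mulr1n.
  apply/rowP => j; rewrite mxE.
  rewrite (_ : lift ord0 j = @rshift 1 n j); last exact/val_inj.
  by rewrite [LHS]row_mxEr.
have mg : measurable_fun setT g.
  apply/measurable_fun_pairP; split; first exact: measurable_coord.
  apply: measurable_fun_rVP => i.
  rewrite [X in measurable_fun _ X](_ : _ =
    (fun x : 'rV[R]_n.+1 => x ord0 (lift ord0 i) : measurableTypeR R)).
    exact: measurable_coord.
  by apply/funext => x; rewrite /= mxE.
exists (fun k => g @^-1` (F k `*` G k)).
  apply/esym; rewrite -subTset => x _ /=.
  have [k _ Fk] : (\bigcup_k F k) (g x).1 by rewrite -TF.
  have [l _ Gl] : (\bigcup_k G k) (g x).2 by rewrite -TG.
  exists (maxn k l) => //; split.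
    by move: Fk; exact/subsetPset/ndF/leq_maxl.
  by move: Gl; exact/subsetPset/ndG/leq_maxr.
move=> k; have [[mF Fk] [mG Gk]] := (Foo k, Goo k); split.
  by rewrite -[X in measurable X]setTI; apply: mg => //; exact: measurableX.
rewrite /rV_measure_cons /pushforward -comp_preimage.
rewrite (_ : g \o rV_cons = id); last by apply/funext => p /=; rewrite gK.
by rewrite preimage_id product_measure1E// lte_mul_pinfty// ge0_fin_numE.
Qed.

HB.instance Definition _ := Measure_isSigmaFinite.Build _ _ _ rV_measure_cons
  rV_measure_cons_sigma_finite.

End rV_measure_cons.

Fixpoint lebesgue_rV (R : realType) (n : nat) :
    {sigma_finite_measure set ('rV[R]_n) -> \bar R} :=
  match n with
  | 0 => \d_(0 : 'rV[R]_0)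
  | n'.+1 => rV_measure_cons (lebesgue_rV R n')
  end.

(** [u] is Lebesgue measurable: the preimage of every Borel set is the union of
    a Borel set and a Lebesgue-null set, i.e. belongs to the completed
    sigma-algebra. Integrals of such functions against the Borel measure
    [lebesgue_rV] below are the usual ones: for a nonnegative integrand,
    [\int] is the supremum over the Borel simple functions below it, which for
    an integrand that is almost everywhere equal to a Borel function is its
    integral with respect to the completed measure. *)
Definition lebesgue_measurable_fun (R : realType) (n : nat)
    (u : 'rV[R]_n -> R) : Prop :=
  forall B : set (measurableTypeR R), measurable B ->
    completed_algebra_gen (lebesgue_rV R n) (u @^-1` B).

(** ** Carnot groups in exponential coordinates *)

Fixpoint differentiable_class (R : realType) (V W : normedModType R) (k : nat)
    (f : V -> W) : Prop :=
  match k with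
  | 0 => continuous f
  | k'.+1 => (forall x, differentiable f x) /\
             forall v, differentiable_class k' (fun x => 'D_v f x)
  end.

Definition smooth (R : realType) (V W : normedModType R) (f : V -> W) : Prop :=
  forall k, differentiable_class k f.

Section lie_algebra.
Context {R : realType} (n : nat).
Local Notation V := 'rV[R]_n.
Implicit Types (mul : V -> V -> V) (d : 'I_n -> nat) (A B : set V).

(* The left-invariant vector field with value v at the identity 0. *)
Definition left_invariant_field mul (v : V) : V -> V :=
  fun x => 'D_v (mul x) 0.

Definition vector_field_bracket (X Y : V -> V) : V -> V :=
  fun x => 'D_(X x) Y x - 'D_(Y x) X x.

(* The Lie algebra is the tangent space at 0, identified with R^n. *)
Definition lie_bracket mul (v w : V) : V :=
  vector_field_bracket (left_invariant_field mul v)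
                       (left_invariant_field mul w) 0.

(* [A, B], the linear span of the brackets. *)
Definition bracket_span mul A B : set V :=
  [set x | exists N (c : 'I_N -> R) (a b : 'I_N -> V),
    (forall l, A (a l) /\ B (b l)) /\
    x = \sum_(l < N) c l *: lie_bracket mul (a l) (b l)].

(* V_i, spanned by the coordinate vectors e_j with d j = i. *)
Definition layer d (i : nat) : set V :=
  [set x | forall j, d j != i -> x ord0 j = 0].

End lie_algebra.

(** [m] is the dimension of the first layer and [m + r] that of the group, so
    that [z = row_mx z' z''] with [z' : 'rV_m] and [z'' : 'rV_r]. *)
Record carnot_group (R : realType) (m r : nat) := CarnotGroup {
  step : nat;
  weight : 'I_(m + r) -> nat;
  cmul : 'rV[R]_(m + r) -> 'rV[R]_(m + r) -> 'rV[R]_(m + r);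
  cinv : 'rV[R]_(m + r) -> 'rV[R]_(m + r);
  cmulA : associative cmul;
  cmul0x : left_id 0 cmul;
  cmulVx : left_inverse 0 cinv cmul;
  cmul_smooth :
    smooth (fun p : 'rV[R]_(m + r) * 'rV[R]_(m + r) => cmul p.1 p.2);
  cinv_smooth : smooth cinv;
  (* Exponential coordinates: t |-> t x is the one-parameter subgroup with
     velocity x at 0, i.e. the exponential map is the identity of R^(m + r). *)
  cmul_ray : forall (s t : R) x, cmul (s *: x) (t *: x) = (s + t) *: x;
  (* The coordinates are adapted to the stratification. *)
  weight_step : forall j, (1 <= weight j <= step)%N;
  weight_nondecreasing : {homo weight : i j / (i <= j)%N};
  weight_horizontal : forall j, (weight j == 1%N) = (j < m)%N;
  (* V_step <> 0; V_i = 0 for i > step by weight_step. *)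
  last_layer : exists j, weight j = step;
  (* Taking i = step gives [V_1, V_step] = 0, hence nilpotency. *)
  stratification : forall i, (1 <= i)%N ->
    bracket_span cmul (layer weight 1) (layer weight i) = layer weight i.+1
}.

Section carnot.
Context {R : realType} {m r : nat} (G : carnot_group R m r).
Local Notation V := 'rV[R]_(m + r).

Definition layer_dim (i : nat) : nat := #|[pred j | weight G j == i]|.

Definition homogeneous_dim : nat :=
  (\sum_(1 <= i < (step G).+1) i * layer_dim i)%N.

Definition dilation (lambda : R) (x : V) : V :=
  \row_j (lambda ^+ weight G j * x ord0 j).

Record is_homogeneous_norm (N : V -> R) : Prop := {
  hnorm_continuous : continuous N;
  hnorm_ge0 : forall x, 0 <= N x;
  hnorm_eq0 : forall x, N x = 0 <-> x = 0;
  hnorm_inv : forall x, N (cinv G x) = N x;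
  hnorm_dilation : forall lambda x, 0 < lambda ->
    N (dilation lambda x) = lambda * N x;
  hnorm_rotation : forall (A : 'M[R]_m) (z' : 'rV[R]_m) (z'' : 'rV[R]_r),
    A *m A^T = 1%:M -> \det A = 1 ->
    N (row_mx (z' *m A^T) z'') = N (row_mx z' z'');
  hnorm_triangle : forall x y,
    `|N y - N x| <= N (cmul G (cinv G y) x) <= N x + N y
}.

Definition ball_volume (N : V -> R) : \bar R :=
  lebesgue_rV R (m + r) [set x | N x < 1].

End carnot.

(** ** Orlicz functions *)

Section orlicz.
Context {R : realType}.
Implicit Types phi : R -> R.

(* Only the values of phi on [0, +oo[ matter. *)
Definition orlicz_fun phi (t : R) : R :=
  (\int[@lebesgue_measure R]_(s in `[0, t]) phi s)%R.

Record is_orlicz phi (pm pp : R) : Prop := {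
  orlicz_density0 : phi 0 = 0;
  orlicz_density_gt0 : forall t, 0 < t -> 0 < phi t;
  orlicz_density_nondecreasing : forall s t, 0 <= s -> s <= t ->
    phi s <= phi t;
  orlicz_density_right_continuous : forall t, 0 <= t ->
    phi s @[s --> t^'+] --> phi t;
  orlicz_density_pinfty : phi t @[t --> +oo] --> +oo;
  orlicz_fun1 : orlicz_fun phi 1 = 1;
  orlicz_exponent_gt1 : 1 < pm;
  orlicz_exponent_le : pm <= pp;
  orlicz_growth : forall t, 0 < t ->
    pm <= t * phi t / orlicz_fun phi t <= pp
}.

Definition doubling phi (C : R) : Prop :=
  0 < C /\ forall t, 0 <= t -> orlicz_fun phi (2 * t) <= C * orlicz_fun phi t.

Definition is_delta2_constant phi (C : R) : Prop :=
  doubling phi C /\ forall C', doubling phi C' -> C <= C'.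

End orlicz.

(** ** Functionals and fractional Orlicz-Sobolev spaces *)

Section functionals.
Context {R : realType} {m r : nat} (G : carnot_group R m r).
Local Notation V := 'rV[R]_(m + r).
Local Notation leb := (lebesgue_rV R (m + r)).
Implicit Types (N : V -> R) (phi : R -> R) (u : V -> R).

Definition modular phi u : \bar R :=
  (\int[leb]_x (orlicz_fun phi `|u x|)%:E)%E.

(* On the diagonal, a null set, the integrand is 0 by the convention x / 0 = 0. *)
Definition frac_modular N phi (s : R) u : \bar R :=
  (\int[leb \x leb]_p
    (let D := N (cmul G (cinv G p.2) p.1) in
     orlicz_fun phi (`|u p.1 - u p.2| / D `^ s) / D ^+ homogeneous_dim G)%:E)%E.

Definition frac_space N phi (s : R) : set (V -> R) :=
  [set u | [/\ lebesgue_measurable_fun u, (modular phi u < +oo)%E &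
               (frac_modular N phi s u < +oo)%E]].

End functionals.

(* Main.v *)
From HB Require Import structures.
Require Import Defs.
From mathcomp Require Import all_boot all_order all_algebra.
From mathcomp Require Import all_classical all_reals all_analysis.
From mathcomp Require Import measurable_realfun ring lra.
Import Order.TTheory GRing.Theory Num.Theory.
Import numFieldNormedType.Exports.

(** The idea of the proof. Write [D] for the distance [N (y^-1 x)], [C_b] for the
    volume of the unit ball and [Phi] for the Orlicz function. All balls satisfy
    [|B(y, r)| = r^Q C_b] ([lebesgue_ball]), so Tonelli's theorem gives
    [Q C_b M^-a / a] for the integral of [D^-(Q + a)] over [D >= M]
    ([radial_integral]). For [a = s p], multiplication by [s] leaves
    [(Q C_b / p) M^-(s p)], which tends to [Q C_b / p] for every [M]: the limit
    only sees pairs of points that are far apart.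

    Upper bound ([fractional_modular_upper]). Where [D < 1] the integrand grows
    with [s], so it is at most the one at the exponent [s0] for which the modular
    is finite, and [s] times that modular tends to [0]. Where [D >= 1], convexity
    and doubling give [Phi (a + b) <= C / 2 * (Phi a + Phi b)], and the growth
    hypothesis integrates to [Phi (t / D^s) <= D^-(s pm) * Phi t]; each of the two
    symmetric terms is then a radial integral.

    Lower bound ([fractional_modular_lower]). Consider the pairs with
    [D >= 3 N(y) + 2]; this region is disjoint from its mirror image. Convexity
    and doubling give
    [2 / C * Phi (|u y| / D^s) <= Phi (|u x - u y| / D^s) + Phi (|u x| / D^s)].
    The left-hand side is at least [2 / C * D^-(s pp) * Phi |u y|], which produces
    a radial integral. The last term is an error which stays bounded as [s] tends
    to [0]: for fixed [x], the points [y] of the region lie in the ball of radius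
    [N(x) / 2] about the identity, of volume [C_b (N(x) / 2)^Q], while
    [D >= N(x) / 2]. Hence it disappears after multiplication by [s]; the two
    mirror regions together give the constant [4 / C], and monotone convergence
    removes the factor [(3 N(y) + 2)^-(s pp)].

    The volume of balls requires the invariance of Lebesgue measure under left
    translations, while the group law is only known to be smooth, associative and
    additive along rays. In coordinates ordered by weight, left translations are
    triangular with unit diagonal ([cmul_triangular]), and triangular maps
    transform the measure in the obvious way by Fubini's theorem
    ([lebesgue_rV_triangular]). For triangularity, the second order term of the
    group law at the identity is half the Lie bracket, so it satisfies the Jacobi
    identity and, by stratification, adds weights. Along a ray [t v], the
    Maurer-Cartan form times [t] solves the linear equation [y' = w - [v, y]],
    from which it is the identity up to terms of higher weight. The differential
    of a translation is a product of such forms and of their inverses.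

    A Lebesgue measurable [u] is replaced by a Borel function equal to it almost
    everywhere ([borel_version]). *)

Set Implicit Arguments.
Unset Strict Implicit.
Unset Printing Implicit Defensive.

Local Open Scope classical_set_scope.
Local Open Scope ring_scope.

(** * Directional derivatives of smooth functions *)

Section directional_derivatives.
Context {R : realType}.
Implicit Types U V W : normedModType R.

Lemma derive_comp U V W (g : U -> V) (f : V -> W) x v :
  differentiable g x -> differentiable f (g x) ->
  'D_v (f \o g) x = 'D_('D_v g x) f (g x).
Proof.
move=> dg df; rewrite deriveE; last exact: differentiable_comp.
by rewrite diff_comp //= !deriveE.
Qed.

Lemma derive_dirP U V (f : U -> V) x (a : R) v w : differentiable f x ->
  'D_(a *: v + w) f x = a *: 'D_v f x + 'D_w f x.
Proof. by move=> df; rewrite !deriveE // linearP. Qed.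

Lemma derive_dir_sum U V (f : U -> V) x n (c : 'I_n -> R) (u : 'I_n -> U) :
  differentiable f x ->
  'D_(\sum_j c j *: u j) f x = \sum_j c j *: 'D_(u j) f x.
Proof.
move=> df; rewrite deriveE // linear_sum; apply: eq_bigr => j _.
by rewrite linearZ deriveE.
Qed.

(** A directional derivative only sees the function along a line. *)
Lemma derive_along U V W (f : U -> W) (g : V -> W) x v y w :
  (forall h : R, f (h *: v + x) = g (h *: w + y)) -> 'D_v f x = 'D_w g y.
Proof.
move=> fg; rewrite /derive.
suff -> : (fun h => h^-1 *: ((f \o shift x) (h *: v) - f x)) =
          (fun h => h^-1 *: ((g \o shift y) (h *: w) - g y)) by [].
apply/funext => h /=; rewrite fg.
by congr (_ *: (_ - _)); move: (fg 0); rewrite !scale0r !add0r.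
Qed.

Lemma derive_pair U V W (f : U -> V) (g : U -> W) x v :
  differentiable f x -> differentiable g x ->
  'D_v (fun y => (f y, g y)) x = ('D_v f x, 'D_v g x).
Proof.
move=> df dg; rewrite deriveE; last exact: differentiable_pair.
by rewrite diff_pair // !deriveE.
Qed.

Lemma is_derive_scale U W (k : U -> R) (g : U -> W) x v :
  derivable k x v -> derivable g x v ->
  is_derive x v (fun y => k y *: g y) ('D_v k x *: g x + k x *: 'D_v g x).
Proof.
move=> dk dg.
suff kg : (fun h => h^-1 *: (((fun y => k y *: g y) \o shift x) (h *: v) -
    k x *: g x)) @ 0^' --> 'D_v k x *: g x + k x *: 'D_v g x.
  by split; [apply/cvg_ex; eexists; exact: kg|exact: cvg_lim kg].
rewrite [X in X @ _](_ : _ = fun h =>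
    (h^-1 * (k (h *: v + x) - k x)) *: g x +
    k (h *: v + x) *: (h^-1 *: (g (h *: v + x) - g x))); last first.
  apply/funext => h /=; rewrite [X in _ = _ + X]scalerA [k _ * h^-1]mulrC.
  rewrite -!scalerA -scalerDr; congr (_ *: _).
  by rewrite scalerBl scalerBr [RHS]addrC addrA subrK.
apply: cvgD.
  by apply: cvgZr_tmp; exact: dk.
apply: cvg_comp2 (@scale_continuous _ _ (_, _)) => /=; last exact: dg.
suff : {for 0, continuous (fun h : R => k (h *: v + x))}.
  by move=> /continuous_withinNx; rewrite scale0r add0r.
exact/differentiable_continuous/derivable1_diffP/(derivable1P _ _ _).1.
Qed.

End directional_derivatives.

Section smooth_functions.
Context {R : realType}.
Implicit Types U V W : normedModType R.

(** The derivative of [y |-> 'D_(Y y) f (g y)] with a moving direction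
    [Y y = \sum_j c j y *: u j] has two terms, because the derivative is linear
    in its direction. *)
Lemma derive_moving_direction U V W n (c : 'I_n -> V -> R) (u : 'I_n -> U)
    (f : U -> W) (g : V -> U) y q :
  (forall x, differentiable f x) ->
  (forall v x, differentiable ('D_v f) x) ->
  (forall j, differentiable (c j) y) -> differentiable g y ->
  'D_q (fun z => 'D_(\sum_j c j z *: u j) f (g z)) y =
  'D_(\sum_j 'D_q (c j) y *: u j) f (g y) +
  'D_('D_q g y) ('D_(\sum_j c j y *: u j) f) (g y).
Proof.
move=> df ddf dc dg.
have -> : (fun z => 'D_(\sum_j c j z *: u j) f (g z)) =
          \sum_j (fun z => c j z *: ('D_(u j) f \o g) z).
  by apply/funext => z; rewrite fct_sumE derive_dir_sum.
have dcg j : is_derive y q (fun z => c j z *: ('D_(u j) f \o g) z)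
    ('D_q (c j) y *: 'D_(u j) f (g y) +
     c j y *: 'D_('D_q g y) ('D_(u j) f) (g y)).
  have H : differentiable ('D_(u j) f \o g) y by exact: differentiable_comp.
  rewrite -derive_comp //.
  by apply: is_derive_scale; exact: diff_derivable.
rewrite derive_sum; last by move=> j; case: (dcg j).
rewrite derive_dir_sum //.
have -> : 'D_(\sum_j c j y *: u j) f = \sum_j (c j y *: 'D_(u j) f).
  by apply/funext => z; rewrite fct_sumE derive_dir_sum.
rewrite [in RHS]derive_sum; last by move=> j; exact/derivableZ/diff_derivable.
rewrite -big_split /=; apply: eq_bigr => j _.
rewrite deriveZ; last exact: diff_derivable.
by case: (dcg j).
Qed.

(** [A] is affine with linear part [L]; the point is that precomposition with
    such maps preserves smoothness by an immediate induction on the order. *)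
Definition affine_map U V (A L : U -> V) : Prop :=
  forall x, differentiable A x /\ forall v, 'D_v A x = L v.

Lemma differentiable_class_affine U V W (A L : U -> V) k (f : V -> W) :
  affine_map A L -> differentiable_class k f -> differentiable_class k (f \o A).
Proof.
move=> AL; elim: k f => [|k IH] f /=.
  move=> cf x; apply: continuous_comp; last exact: cf.
  by apply: differentiable_continuous; case: (AL x).
move=> [df Df]; split=> [x|v].
  by apply: differentiable_comp; [case: (AL x)|exact: df].
rewrite (_ : (fun x => _) = 'D_(L v) f \o A); first exact: IH.
apply/funext => x; rewrite derive_comp //; first by case: (AL x) => _ ->.
by case: (AL x).
Qed.

Lemma smooth_affine U V W (A L : U -> V) (f : V -> W) :
  affine_map A L -> smooth f -> smooth (f \o A).
Proof. by move=> AL sf k; exact: differentiable_class_affine AL (sf k). Qed.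

Lemma smooth_differentiable U V (f : U -> V) x : smooth f -> differentiable f x.
Proof. by move=> /(_ 1%N)[]. Qed.

Lemma smooth_derive U V (f : U -> V) v : smooth f -> smooth ('D_v f).
Proof. by move=> sf k; have [_] := sf k.+1; apply. Qed.

Lemma smooth_continuous U V (f : U -> V) : smooth f -> continuous f.
Proof. by move=> /(_ 0%N). Qed.

Lemma affine_pairl U V (y : V) : affine_map (fun x : U => (x, y)) (fun v => (v, 0)).
Proof.
move=> x; split; first exact: differentiable_pair.
by move=> v; rewrite derive_pair // derive_id derive_cst.
Qed.

Lemma affine_pairr U V (x : U) : affine_map (fun y : V => (x, y)) (fun v => (0, v)).
Proof.
move=> y; split; first exact: differentiable_pair.
by move=> v; rewrite derive_pair // derive_id derive_cst.
Qed.

(** Two applications of the mean value theorem turn the second difference of [f]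
    into a mixed second derivative at a nearby point. *)
Lemma second_difference U (f : U -> R) x v w (h : R) : 0 < h ->
  (forall y, differentiable f y) -> (forall y, differentiable ('D_v f) y) ->
  exists a b, [/\ 0 <= a <= h, 0 <= b <= h &
    f (h *: v + (h *: w + x)) - f (h *: v + x) - (f (h *: w + x) - f x) =
    h * h * 'D_w ('D_v f) (a *: v + (b *: w + x))].
Proof.
move=> h0 df dvf.
have line (g : U -> R) y z t : (forall y, differentiable g y) ->
    is_derive t (1 : R) (fun t => g (t *: z + y)) ('D_z g (t *: z + y)).
  move=> dg.
  have dl : is_diff t (fun s : R => s *: z + y) (fun s : R => s *: z).
    apply: is_diff_eq; apply/funext => s /=.
    by rewrite -[RHS]addr0.
  split.
    apply/diff_derivable/(@differentiable_comp _ _ _ _ (fun t : R => t *: z + y)) => //.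
  have D1 : 'D_1 (fun s : R => s *: z + y) t = z.
    by rewrite deriveE // diff_val /= scale1r.
  by have := derive_comp (1 : R) (@ex_diff _ _ _ _ _ _ _ dl) (dg (t *: z + y)); rewrite D1.
pose G t := f (t *: v + (h *: w + x)) - f (t *: v + x).
have dG t : is_derive t (1 : R) G
    ('D_v f (t *: v + (h *: w + x)) - 'D_v f (t *: v + x)).
  by apply: is_deriveB; exact: (line f _ v).
have cont (g dg : R -> R) : (forall t, is_derive t (1 : R) g (dg t)) ->
    {within `[0, h], continuous g}.
  move=> H; apply: continuous_subspaceT => t.
  by apply/differentiable_continuous/derivable1_diffP; case: (H t).
have [a ah Ga] := MVT_segment (ltW h0) (fun t _ => dG t) (cont _ _ dG).
have dK t : is_derive t (1 : R) (fun t => 'D_v f (t *: w + (a *: v + x)))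
    ('D_w ('D_v f) (t *: w + (a *: v + x))).
  exact: (line ('D_v f) _ w).
have [b bh Kb] := MVT_segment (ltW h0) (fun t _ => dK t) (cont _ _ dK).
exists a, b; split; [by move: ah; rewrite in_itv|by move: bh; rewrite in_itv|].
move: Ga Kb; rewrite /G !scale0r !add0r !subr0.
rewrite [a *: v + (h *: w + x)]addrCA => -> ->.
by rewrite [b *: w + _]addrCA -mulrA mulrC.
Qed.

(** If the two mixed derivatives differed at [x], continuity would keep them
    apart near [x], where both represent the same second difference. *)
Lemma derive_swap_scalar U (f : U -> R) x v w :
  (forall y, differentiable f y) ->
  (forall z y, differentiable ('D_z f) y) ->
  (forall z z', continuous ('D_z ('D_z' f))) ->
  'D_w ('D_v f) x = 'D_v ('D_w f) x.
Proof.
move=> df ddf cddf; apply/eqP; rewrite -subr_eq0; apply/negPn/negP => ne.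
pose e := `|'D_w ('D_v f) x - 'D_v ('D_w f) x| / 2.
have e0 : 0 < e by rewrite divr_gt0 // normr_gt0.
have near0 (g : U -> R) y1 y2 : continuous g -> exists2 d : R, 0 < d &
    forall a b h, h < d -> 0 <= a <= h -> 0 <= b <= h ->
      `|g x - g (a *: y1 + (b *: y2 + x))| < e.
  move=> cg; have /cvgrPdist_lt /(_ _ e0) /nbhs_ballP[d /= d0 dg] := cg x.
  have n0 : 0 < 1 + `|y1| + `|y2| by rewrite -addrA ltr_pwDl // addr_ge0.
  exists (d / (1 + `|y1| + `|y2|)); first exact: divr_gt0.
  move=> a b h hd /andP[a0 ad] /andP[b0 bd]; apply: dg.
  rewrite -ball_normE /= addrA opprD addrCA subrr addr0 normrN.
  apply: (le_lt_trans (ler_normD _ _)); rewrite !normrZ !ger0_norm //.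
  have h0 : 0 <= h by exact: le_trans ad.
  rewrite ltr_pdivlMr // in hd; apply: le_lt_trans hd.
  rewrite !mulrDr mulr1 -addrA ler_wpDl // lerD // ler_wpM2r //.
have [d1 d10 near1] := near0 _ v w (cddf w v).
have [d2 d20 near2] := near0 _ w v (cddf v w).
pose h := Num.min d1 d2 / 2.
have m0 : 0 < Num.min d1 d2 by rewrite lt_min d10.
have h0 : 0 < h by rewrite divr_gt0.
have /andP[hd1 hd2] : (h < d1) && (h < d2).
  by rewrite -lt_min /h ltr_pdivrMr // mulr_natr mulr2n ltrDl.
have [a [b [ah bh E1]]] := @second_difference _ f x v w _ h0 df (ddf v).
have [a' [b' [ah' bh' E2]]] := @second_difference _ f x w v _ h0 df (ddf w).
have E : 'D_w ('D_v f) (a *: v + (b *: w + x)) =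
         'D_v ('D_w f) (a' *: w + (b' *: v + x)).
  apply: (mulfI (_ : h * h != 0)); first by rewrite mulf_neq0 // gt_eqF.
  apply: (etrans (esym E1)); apply: (etrans _ E2).
  rewrite [h *: v + (h *: w + x)]addrCA !opprB addrACA [RHS]addrACA.
  by congr (_ + _); exact: addrC.
have := near1 _ _ _ hd1 ah bh; have := near2 _ _ _ hd2 ah' bh'; rewrite E.
set P := 'D_v _ (_ + _) => A B.
suff : `|'D_w ('D_v f) x - 'D_v ('D_w f) x| < e + e.
  by rewrite -splitr ltxx.
rewrite -(subrKA P); apply: (le_lt_trans (ler_normD _ _)).
by apply: ltrD; [exact: B|rewrite distrC; exact: A].
Qed.

End smooth_functions.

(** The directional derivative, locked: comparing two derivatives would otherwise
    unfold both of them to limits of filters. *)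
HB.lock Definition dder {R : realType} {U W : normedModType R} (v : U)
  (f : U -> W) : U -> W := 'D_v f.

Section locked_derivative.
Context {R : realType}.
Implicit Types U V W : normedModType R.

Lemma dderE U W v (f : U -> W) : dder v f = 'D_v f.
Proof. by rewrite dder.unlock. Qed.

Lemma dder_comp U V W (g : U -> V) (f : V -> W) x v :
  differentiable g x -> differentiable f (g x) ->
  dder v (f \o g) x = dder (dder v g x) f (g x).
Proof. by move=> dg df; rewrite !dderE; exact: derive_comp. Qed.

Lemma dder_dir_linear U V (f : U -> V) x : differentiable f x ->
  linear (fun v => dder v f x).
Proof. by move=> df a v w; rewrite !dderE; exact: derive_dirP. Qed.

Lemma dder_along U V W (f : U -> W) (g : V -> W) x v y w :
  (forall h : R, f (h *: v + x) = g (h *: w + y)) -> dder v f x = dder w g y.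
Proof. by rewrite !dderE; exact: derive_along. Qed.

Lemma dder_pair U V W (f : U -> V) (g : U -> W) x v :
  differentiable f x -> differentiable g x ->
  dder v (fun y => (f y, g y)) x = (dder v f x, dder v g x).
Proof. by rewrite !dderE; exact: derive_pair. Qed.

Lemma dder_id U (x v : U) : dder v id x = v.
Proof. by rewrite dderE derive_id. Qed.

Lemma dder_cst U W (w : W) (x v : U) : dder v (cst w) x = 0.
Proof. by rewrite dderE derive_cst. Qed.

Lemma dder_pairr U V (x : U) (y v : V) : dder v (fun z => (x, z)) y = (0, v).
Proof. by rewrite dderE; case: (affine_pairr x y). Qed.

Lemma dder_pairl U V (y : V) (x v : U) : dder v (fun z => (z, y)) x = (v, 0).
Proof. by rewrite dderE; case: (affine_pairl y x). Qed.

Lemma dderD U W (f g : U -> W) x v : differentiable f x -> differentiable g x ->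
  dder v (fun y => f y + g y) x = dder v f x + dder v g x.
Proof.
by move=> df dg; rewrite !dderE; apply: deriveD; exact: diff_derivable.
Qed.

Lemma dderZ U W a (f : U -> W) x v : differentiable f x ->
  dder v (fun y => a *: f y) x = a *: dder v f x.
Proof. by move=> df; rewrite !dderE; apply: deriveZ; exact: diff_derivable. Qed.

Lemma dderB U W (f g : U -> W) x v : differentiable f x -> differentiable g x ->
  dder v (fun y => f y - g y) x = dder v f x - dder v g x.
Proof.
by move=> df dg; rewrite !dderE; apply: deriveB; exact: diff_derivable.
Qed.

Lemma dder_line U (a : U) (t : R) : dder (1 : R) (fun s : R => s *: a) t = a.
Proof.
rewrite -[RHS](dder_id (t *: a) a); apply: dder_along => k.
by rewrite [k *: 1]mulr1 scalerDl.
Qed.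

Lemma is_derive_line U (a : U) (t : R) : is_derive t (1 : R) (fun s : R => s *: a) a.
Proof.
split; first exact: diff_derivable.
by have := dder_line a t; rewrite dderE.
Qed.

Lemma smooth_dder U W (f : U -> W) v : smooth f -> smooth (dder v f).
Proof. by rewrite dderE; exact: smooth_derive. Qed.

(** Linear coordinates on a finite-dimensional space; each [c j] is its own
    differential. *)
Definition linear_coordinates V n (e : 'I_n -> V) (c : 'I_n -> V -> R) : Prop :=
  (forall v, v = \sum_j c j v *: e j) /\ forall j, affine_map (c j) (c j).

Section coordinates.
Context (V : normedModType R) n (e : 'I_n -> V) (c : 'I_n -> V -> R).
Hypothesis ce : linear_coordinates e c.

Lemma coordinate_linear j : linear (c j : V -> R^o).
Proof.
move=> a v w; have [dc Dc] := ce.2 j 0.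
by have := derive_dirP a v w dc; rewrite !Dc.
Qed.

Lemma coordinateD j x y : c j (x + y) = c j x + c j y.
Proof. by have := coordinate_linear j 1 x y; rewrite !scale1r. Qed.

Lemma coordinate0 j : c j 0 = 0.
Proof.
have := coordinateD j 0 0; rewrite addr0 => /eqP.
by rewrite -subr_eq0 opprD addNKr oppr_eq0 => /eqP.
Qed.

Lemma coordinateZ j a x : c j (a *: x) = a * c j x.
Proof. by have := coordinate_linear j a x 0; rewrite coordinate0 !addr0. Qed.

Lemma coordinateN j x : c j (- x) = - c j x.
Proof. by rewrite -scaleN1r coordinateZ mulN1r. Qed.

Lemma coordinate_differentiable U (f : U -> V) j x :
  differentiable f x -> differentiable (c j \o f) x.
Proof. by move=> df; apply: differentiable_comp => //; case: (ce.2 j (f x)). Qed.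

Lemma coordinate_dder U (f : U -> V) j x v :
  differentiable f x -> c j (dder v f x) = dder v (c j \o f) x.
Proof.
by move=> df; have [dc Dc] := ce.2 j (f x); rewrite -Dc dderE dderE -derive_comp.
Qed.

(** Schwarz's theorem, reduced to the scalar case by taking coordinates. *)
Lemma dder_swap U (f : U -> V) x v w : smooth f ->
  dder w (dder v f) x = dder v (dder w f) x.
Proof.
move=> sf.
have df y : differentiable f y by exact: smooth_differentiable.
have sD z y : differentiable (dder z f) y by exact/smooth_differentiable/smooth_dder.
have E j z : c j \o dder z f = dder z (c j \o f).
  by apply/funext => y; exact: coordinate_dder.
have entry2 j z z' : c j \o dder z (dder z' f) = dder z (dder z' (c j \o f)).
  by rewrite -E; apply/funext => y; exact: coordinate_dder.
apply: etrans (ce.1 _) _; apply: etrans _ (esym (ce.1 _)).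
apply: eq_bigr => j _.
suff -> : c j (dder w (dder v f) x) = c j (dder v (dder w f) x) by [].
have := congr1 (@^~ x) (entry2 j w v); have := congr1 (@^~ x) (entry2 j v w).
move=> /= -> ->; rewrite !dderE; apply: derive_swap_scalar.
- by move=> y; exact: coordinate_differentiable.
- by move=> z y; rewrite -dderE -E; exact: coordinate_differentiable.
- move=> z z' y; rewrite -!dderE -entry2.
  apply/differentiable_continuous/coordinate_differentiable.
  by apply: smooth_differentiable; do 2 apply: smooth_dder.
Qed.

(** The direction [J (Y z)] moves with the point; [J] is either the identity or
    the embedding of a factor. *)
Lemma dder_moving U V' W (J : V -> U) (Y : V' -> V) (f : U -> W) (g : V' -> U) y q :
  linear J -> smooth f -> differentiable Y y -> differentiable g y ->
  dder q (fun z => dder (J (Y z)) f (g z)) y =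
  dder (J (dder q Y y)) f (g y) + dder (dder q g y) (dder (J (Y y)) f) (g y).
Proof.
move=> linJ sf dY dg.
pose JL : {linear V -> U} := HB.pack J (GRing.isLinear.Build _ _ _ _ _ linJ).
have JE v : J v = \sum_j c j v *: J (e j).
  rewrite {1}[v]ce.1 -[J _]/(JL _) linear_sum.
  by apply: eq_bigr => j _; rewrite linearZ.
pose k j z : R := c j (Y z); pose u j := J (e j).
have dk j : differentiable (k j) y by exact: coordinate_differentiable.
have := derive_moving_direction u q (fun x => smooth_differentiable x sf)
  (fun v x => smooth_differentiable x (smooth_derive v sf)) dk dg.
have -> : (fun z => 'D_(\sum_j k j z *: u j) f (g z)) =
    (fun z => dder (J (Y z)) f (g z)).
  by apply/funext => z; rewrite JE dderE.
rewrite -[\sum_j k j y *: u j]JE => E; rewrite {1}dderE E.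
have -> : \sum_j 'D_q (k j) y *: u j = J (dder q Y y).
  by rewrite JE; apply: eq_bigr => j _; rewrite coordinate_dder // dderE.
by rewrite !dderE.
Qed.

Lemma dder_moving_field W (Y : V -> V) (f : V -> W) y q :
  smooth f -> smooth Y ->
  dder q (fun z => dder (Y z) f z) y =
  dder (dder q Y y) f y + dder q (dder (Y y) f) y.
Proof.
move=> sf sY; have idd : differentiable (id : V -> V) y by [].
have := dder_moving (J := id) q (fun _ _ _ => erefl) sf
  (smooth_differentiable y sY) idd.
by rewrite dder_id.
Qed.

End coordinates.
End locked_derivative.

(** * Group laws in exponential coordinates *)

Lemma linear_fun0 (R : pzRingType) (U W : lmodType R) (f : U -> W) :
  linear f -> f 0 = 0.
Proof.
move=> lf; pose L : {linear U -> W} := HB.pack f (GRing.isLinear.Build _ _ _ _ _ lf).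
exact: (linear0 L).
Qed.

Lemma linear_funZ (R : pzRingType) (U W : lmodType R) (f : U -> W) a x :
  linear f -> f (a *: x) = a *: f x.
Proof.
move=> lf; pose L : {linear U -> W} := HB.pack f (GRing.isLinear.Build _ _ _ _ _ lf).
exact: (linearZ_LR L).
Qed.

Lemma linear_funN (R : pzRingType) (U W : lmodType R) (f : U -> W) x :
  linear f -> f (- x) = - f x.
Proof. by move=> lf; rewrite -scaleN1r (linear_funZ _ _ lf) scaleN1r. Qed.

Lemma linear_funD (R : pzRingType) (U W : lmodType R) (f : U -> W) x y :
  linear f -> f (x + y) = f x + f y.
Proof. by move=> lf; have := lf 1 x y; rewrite !scale1r. Qed.

(** A smooth group law on a vector space for which rays are one-parameter
    subgroups, that is, a Lie group in exponential coordinates. *)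
Record exponential_law {R : realType} (V : normedModType R) (mul : V -> V -> V) :
    Prop := ExponentialLaw {
  explawA : associative mul;
  explaw0x : left_id 0 mul;
  explaw_smooth : smooth (fun p : V * V => mul p.1 p.2);
  explaw_ray : forall (s t : R) x, mul (s *: x) (t *: x) = (s + t) *: x
}.

Section exponential_law.
Context {R : realType} {V : normedModType R} {n : nat}.
Context (e : 'I_n -> V) (c : 'I_n -> V -> R) (ce : linear_coordinates e c).
Context (mul : V -> V -> V) (mulP : exponential_law mul).

Let mu (p : V * V) := mul p.1 p.2.
Let smooth_mu : smooth mu := explaw_smooth mulP.

Lemma explawx0 x : mul x 0 = x.
Proof. by have := explaw_ray mulP 1 0 x; rewrite addr0 scale1r scale0r. Qed.

Lemma explawxN x : mul x (- x) = 0.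
Proof. by have := explaw_ray mulP 1 (-1) x; rewrite subrr scale0r scale1r scaleN1r. Qed.

Lemma explawNx x : mul (- x) x = 0.
Proof. by have := explaw_ray mulP (-1) 1 x; rewrite addNr scale0r scale1r scaleN1r. Qed.

Lemma explawNK x y : mul (- x) (mul x y) = y.
Proof. by rewrite (explawA mulP) explawNx (explaw0x mulP). Qed.

Lemma explawKN x y : mul x (mul (- x) y) = y.
Proof. by rewrite (explawA mulP) explawxN (explaw0x mulP). Qed.

Lemma dder_left p x y : dder p (mul x) y = dder (0, p) mu (x, y).
Proof.
apply: dder_along => h; rewrite /mu /=; congr (mul _ _).
by rewrite scaler0 add0r.
Qed.

Lemma dder_right p x y : dder p (mul^~ y) x = dder (p, 0) mu (x, y).
Proof.
apply: dder_along => h; rewrite /mu /=; congr (mul _ _).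
by rewrite scaler0 add0r.
Qed.

Lemma smooth_left x : smooth (mul x).
Proof. exact: (smooth_affine (@affine_pairr R V V x) smooth_mu). Qed.

(** The left-invariant vector field with value [q] at the identity. *)
Definition lfield q x := dder q (mul x) 0.

Lemma lfieldE q : lfield q = dder (0, q) mu \o (fun x => (x, 0)).
Proof. by apply/funext => x; rewrite /lfield dder_left. Qed.

Lemma smooth_lfield q : smooth (lfield q).
Proof.
rewrite lfieldE; apply: (smooth_affine (@affine_pairl R V V 0)).
exact: smooth_dder.
Qed.

Lemma lfield0 q : lfield q 0 = q.
Proof.
rewrite /lfield (_ : mul 0 = id) ?dder_id //.
by apply/funext => x; exact: (explaw0x mulP).
Qed.

Lemma lfield_linear x : linear (fun q => lfield q x).
Proof. exact/dder_dir_linear/smooth_differentiable/smooth_left. Qed.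

(** The second order term of the group law at the identity, which will be half
    of the Lie bracket. *)
Definition mul2 p q := dder p (lfield q) 0.

Lemma mul2_linearl q : linear (mul2^~ q).
Proof. exact/dder_dir_linear/smooth_differentiable/smooth_lfield. Qed.

Lemma mul2_linearr p : linear (mul2 p).
Proof.
move=> a q q'; rewrite /mul2.
have -> : lfield (a *: q + q') = fun x => a *: lfield q x + lfield q' x.
  by apply/funext => x; rewrite lfield_linear.
have d z : differentiable (lfield z) 0.
  exact/smooth_differentiable/smooth_lfield.
by rewrite dderD ?dderZ //; exact: differentiableZ.
Qed.

(** Rays are one-parameter subgroups, so the field of [x] is constant along the
    ray of [x]. *)
Lemma mul2xx x : mul2 x x = 0.
Proof.
rewrite /mul2 (@dder_along _ _ _ _ _ (cst x) _ _ (0 : V) x) ?dder_cst //.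
move=> h; rewrite addr0 /lfield.
rewrite (@dder_along _ _ _ _ _ id _ _ (h *: x) x) ?dder_id //.
by move=> k; rewrite addr0 (explaw_ray mulP) scalerDl addrC.
Qed.

Lemma mul2C p q : mul2 p q = - mul2 q p.
Proof.
have := mul2xx (p + q); rewrite (linear_funD _ _ (mul2_linearl _)).
rewrite !(linear_funD _ _ (mul2_linearr _)) !mul2xx add0r addr0.
by move/eqP; rewrite addr_eq0 => /eqP.
Qed.

(** Associativity to first order in the last factor: [lfield q] is invariant
    under left translations. *)
Lemma lfield_mul q x y : lfield q (mul x y) = dder (lfield q y) (mul x) y.
Proof.
have dl z w := smooth_differentiable w (smooth_left z).
have := dder_comp q (dl y 0) (dl x (mul y 0)).
rewrite explawx0 -/(lfield q y) => <-; rewrite /lfield.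
suff -> : mul (mul x y) = mul x \o mul y by [].
by apply/funext => z /=; rewrite (explawA mulP).
Qed.

(** Associativity to first order in both of the last two factors. *)
Lemma dder_lfield q s x :
  dder (lfield q x) (lfield s) x = lfield (mul2 q s) x + dder q (dder s (mul x)) 0.
Proof.
have dl z w := smooth_differentiable w (smooth_left z).
have ds z w := smooth_differentiable w (smooth_lfield z).
have := dder_comp q (dl x 0) (ds s _); rewrite explawx0 => <-.
have -> : lfield s \o mul x = fun z => dder (lfield s z) (mul x) z.
  by apply/funext => z /=; rewrite lfield_mul.
by rewrite (dder_moving_field ce) ?lfield0 //; [exact: smooth_left|exact: smooth_lfield].
Qed.

(** Antisymmetrising the previous identity removes the second derivative of the
    translation. *)
Lemma lfield_bracket q s x :
  dder (lfield q x) (lfield s) x - dder (lfield s x) (lfield q) x =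
  lfield (2 *: mul2 q s) x.
Proof.
rewrite (dder_lfield q s) (dder_lfield s q).
rewrite (dder_swap ce _ q s (smooth_left x)) [mul2 s q]mul2C.
have L := @lfield_linear x.
rewrite (linear_funN _ L) (linear_funZ _ _ L).
by rewrite opprD opprK addrACA subrr addr0 scaler_nat mulr2n.
Qed.

(** Differentiating [lfield_bracket] at the identity produces the two sides of
    the Jacobi identity, up to second derivatives of the fields, which cancel in
    the cyclic sum because they are symmetric. *)
Lemma mul2_bracket p q s :
  mul2 (mul2 p q) s + dder p (dder q (lfield s)) 0 -
  (mul2 (mul2 p s) q + dder p (dder s (lfield q)) 0) = 2 *: mul2 p (mul2 q s).
Proof.
pose H q s x := dder (lfield q x) (lfield s) x.
have E q' s' : dder p (H q' s') 0 = mul2 (mul2 p q') s' + dder p (dder q' (lfield s')) 0.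
  rewrite /H (dder_moving_field ce) ?lfield0 //; exact: smooth_lfield.
have dH q' s' : differentiable (H q' s') 0.
  pose K := dder (0, q') (dder (0, s') mu).
  have sK : smooth K by do 2 apply: smooth_dder.
  have -> : H q' s' = lfield (mul2 q' s') + (K \o (fun x : V => (x, 0))).
    apply/funext => x; rewrite /H dder_lfield; congr (_ + _).
    have -> : dder s' (mul x) = dder (0, s') mu \o (fun y => (x, y)).
      by apply/funext => y; rewrite dder_left.
    rewrite dder_comp ?dder_pairr //; last exact/smooth_differentiable/smooth_dder.
  apply: differentiableD; first exact/smooth_differentiable/smooth_lfield.
  apply: differentiable_comp; first exact: differentiable_pair.
  exact: smooth_differentiable.
rewrite -!E -dderB // -(linear_funZ _ _ (mul2_linearr p)) /mul2.
suff -> : lfield (2 *: mul2 q s) = fun x => H q s x - H s q x by [].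
by apply/funext => x; rewrite -lfield_bracket.
Qed.

(** The cyclic sum of [mul2_bracket]. *)
Lemma mul2_jacobi p q s : mul2 (mul2 p q) s = mul2 p (mul2 q s) - mul2 q (mul2 p s).
Proof.
have := mul2_bracket p q s; have := mul2_bracket q s p.
have := mul2_bracket s p q.
rewrite (dder_swap ce _ p q (smooth_lfield s)).
rewrite (dder_swap ce _ q s (smooth_lfield p)).
rewrite (dder_swap ce _ s p (smooth_lfield q)).
have N x y z : mul2 x (mul2 y z) = - mul2 (mul2 y z) x by exact: mul2C.
have N' x y z : mul2 (mul2 x y) z = - mul2 (mul2 y x) z.
  by rewrite [mul2 x y]mul2C (linear_funN _ (mul2_linearl _)).
rewrite !N (N' s q p) (N' q p s) (N' p s q).
move: (mul2 (mul2 s p) q) (mul2 (mul2 q s) p) (mul2 (mul2 p q) s).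
move: (dder _ _ _) (dder _ _ _) (dder _ _ _) => D1 D2 D3 A B C' E1 E2 E3.
rewrite [LHS]ce.1 [RHS]ce.1; apply: eq_bigr => j _; congr (_ *: _).
move: (congr1 (c j) E1) (congr1 (c j) E2) (congr1 (c j) E3).
have cE := (coordinateD ce, coordinateN ce, coordinateZ ce).
by rewrite !cE; lra.
Qed.

(** The Maurer-Cartan form at [x], applied to [p]. *)
Definition mcform x p := dder p (mul (- x)) x.

(** [t |-> t *: mcform (t *: v) w] solves the linear equation
    [y' = w - 2 *: mul2 v y]; near [t] this follows from the identity below, in
    which only the behaviour at [s = 0] of its right-hand side matters. *)
Let ray_form v w (t : R) := dder (t *: w) (mul (- (t *: v))) (t *: v).

Lemma ray_form_cocycle v w t s :
  ray_form v w (t + s) =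
  dder (dder (ray_form v w t) (mul^~ (s *: v)) 0 + s *: w)
       (mul (- (s *: v))) (s *: v).
Proof.
have dl x y := smooth_differentiable y (smooth_left x).
have dmu p := smooth_differentiable p smooth_mu.
pose base (h : R) := h *: w + v; pose line a h := a *: base h.
have dbase h : differentiable base h by exact: differentiableD.
have dline a h : differentiable (line a) h by exact: differentiableZ.
have Dline a h : dder (1 : R) (line a) h = a *: w.
  rewrite dderZ //; congr (_ *: _).
  rewrite -[RHS](dder_id (base h) w); apply: dder_along => k.
  by rewrite /base [k *: 1]mulr1 scalerDl -addrA.
have line0 a : line a 0 = a *: v by rewrite /line /base scale0r add0r.
pose k h := mul (- (t *: v)) (line t h).
have dk h : differentiable k h by exact: (differentiable_comp (dline t h) (dl _ _)).
have k0 : k 0 = 0 by rewrite /k line0 explawNx.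
have Dk : dder (1 : R) k 0 = ray_form v w t.
  have := dder_comp (1 : R) (dline t 0) (dl (- (t *: v)) _).
  by rewrite Dline line0.
have dks : differentiable (fun h => (k h, line s h)) 0 by exact: differentiable_pair.
have -> : ray_form v w (t + s) =
    dder (1 : R) (mul (- (s *: v)) \o (mu \o (fun h => (k h, line s h)))) 0.
  apply: dder_along => h; rewrite /= /mu /= addr0 /k /line -!scaleNr.
  rewrite -(explawA mulP) (explaw_ray mulP) (explawA mulP) (explaw_ray mulP).
  rewrite [h *: 1]mulr1 -opprD [s + t]addrC; congr (mul _ _).
  by rewrite /base scalerDr !scalerA mulrC.
rewrite (dder_comp (1 : R) (differentiable_comp dks (dmu _)) (dl _ _)).
rewrite (dder_comp (1 : R) dks (dmu _)) dder_pair // Dk Dline /= k0 line0 /mu /= (explaw0x mulP).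
congr (dder _ _ _).
have -> : (ray_form v w t, s *: w) = 1 *: (ray_form v w t, 0 : V) + (0 : V, s *: w).
  by rewrite scale1r; congr pair; rewrite ?addr0 ?add0r.
rewrite (dder_dir_linear (dmu _)) scale1r -dder_right -dder_left.
rewrite (_ : mul 0 = id) ?dder_id //.
by apply/funext => x; exact: (explaw0x mulP).
Qed.

Lemma is_derive_ray_form v w t :
  is_derive t (1 : R) (ray_form v w) (w - 2 *: mul2 v (ray_form v w t)).
Proof.
have dl x y := smooth_differentiable y (smooth_left x).
have dmu p := smooth_differentiable p smooth_mu.
pose P := ray_form v w t.
have dscale a : differentiable (fun s : R => s *: a : V) 0 by [].
pose rf y := dder P (mul^~ y) 0.
have rfE : rf = dder (P, 0) mu \o (fun y => (0, y)).
  by apply/funext => y; rewrite /rf dder_right.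
have sP : smooth (dder (P, 0) mu) by exact: smooth_dder.
have rf0 : rf 0 = P.
  rewrite /rf (_ : mul^~ 0 = id) ?dder_id //.
  by apply/funext => x; exact: explawx0.
have drf : differentiable rf 0.
  rewrite rfE; apply: differentiable_comp; first exact: differentiable_pair.
  exact: smooth_differentiable.
have Drf : dder v rf 0 = mul2 P v.
  rewrite rfE dder_comp ?dder_pairr //; last exact: smooth_differentiable.
  rewrite (dder_swap ce _ _ _ smooth_mu) /mul2 lfieldE.
  have dpl : differentiable (fun x : V => (x, 0 : V)) 0 by exact: differentiable_pair.
  have dv p := smooth_differentiable p (smooth_dder (0, v) smooth_mu).
  by rewrite (dder_comp P dpl (dv _)) dder_pairl.
pose Y (s : R) := rf (s *: v) + s *: w.
have drfs : differentiable (rf \o (fun s : R => s *: v : V)) 0.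
  by apply: differentiable_comp; rewrite // scale0r.
have dY : differentiable Y 0 by exact: differentiableD.
have DY : dder (1 : R) Y 0 = mul2 P v + w.
  rewrite dderD // dder_line; congr (_ + _).
  have d0 : differentiable rf (0 *: v) by rewrite scale0r.
  by have := dder_comp (1 : R) (dscale v) d0; rewrite dder_line scale0r Drf.
have Y0 : Y 0 = P by rewrite /Y !scale0r rf0 addr0.
pose g (s : R) := (- (s *: v), s *: v).
have dN : differentiable (fun s : R => - (s *: v)) 0 by exact: differentiableN.
have dg : differentiable g 0 by exact: differentiable_pair.
have Dg : dder (1 : R) g 0 = (- v, v).
  rewrite dder_pair // dder_line; congr pair.
  rewrite -[in RHS](dder_line v 0) -scaleN1r -dderZ //.
  by congr (dder _ _ _); apply/funext => s; rewrite scaleN1r.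
have g0 : g 0 = (0, 0) by rewrite /g scale0r oppr0.
have cocycle s : ray_form v w (t + s) = dder (0, Y s) mu (g s).
  by rewrite ray_form_cocycle dder_left.
have Jlin : linear (fun p : V => (0 : V, p)).
  by move=> a x y; rewrite -[RHS]/(a *: 0 + 0, a *: x + y) scaler0 addr0.
pose K := dder (0, P) mu.
have dK p : differentiable K p by exact/smooth_differentiable/smooth_dder.
have := dder_moving ce (1 : R) Jlin smooth_mu dY dg.
rewrite DY Dg Y0 g0 -/K -dder_left.
have mul0 : mul 0 = id by apply/funext => x; exact: (explaw0x mulP).
have -> : (- v, v) = -1 *: (v, 0 : V) + (0 : V, v).
  by rewrite -[RHS]/(-1 *: v + 0, -1 *: 0 + v) scaler0 scaleN1r add0r addr0.
rewrite (dder_dir_linear (dK _)) {1}mul0 dder_id.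
have -> : dder (v, 0) K (0, 0) = mul2 v P.
  have dpl : differentiable (fun x : V => (x, 0 : V)) 0 by exact: differentiable_pair.
  by have := dder_comp v dpl (dK _); rewrite dder_pairl -lfieldE.
have -> : dder (0, v) K (0, 0) = 0.
  have dpr : differentiable (fun x : V => (0 : V, x)) 0 by exact: differentiable_pair.
  have := dder_comp v dpr (dK _); rewrite dder_pairr => <-.
  have -> : K \o (fun x => (0, x)) = cst P.
    by apply/funext => x /=; rewrite /K -dder_left mul0 dder_id.
  exact: dder_cst.
rewrite addr0 scaleN1r => E.
have drayE : ray_form v w =
    fun t => t *: (dder (0, w) mu \o (fun t => (- (t *: v), t *: v))) t.
  apply/funext => s; rewrite /= -dder_left.
  exact: (linear_funZ _ _ (dder_dir_linear (dl _ _))).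
have dgt : differentiable (fun t : R => (- (t *: v), t *: v)) t.
  by apply: differentiable_pair => //; exact: differentiableN.
split.
  rewrite drayE; apply: (@ex_derive _ _ _ _ _ _ _ (is_derive_scale _ _)) => //.
  apply/diff_derivable/differentiable_comp => //.
  exact/smooth_differentiable/smooth_dder.
rewrite (_ : 'D_1 _ t = dder (1 : R) (ray_form v w) t); last by rewrite dderE.
transitivity (mul2 P v + w - mul2 v P); last first.
  by rewrite [mul2 P v]mul2C scaler_nat mulr2n opprD addrA addrC addrA addrAC.
rewrite -E; apply: dder_along => h.
by rewrite addr0 [h *: 1]mulr1 addrC cocycle.
Qed.

Section graded.
Context (d : 'I_n -> nat).

Definition weight_ge i : set V := [set x | forall j, (d j < i)%N -> c j x = 0].

Lemma weight_ge_le i k x : (i <= k)%N -> weight_ge k x -> weight_ge i x.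
Proof. by move=> ik kx j ji; apply: kx; exact: leq_trans ik. Qed.

Lemma weight_geB i x y : weight_ge i x -> weight_ge i y -> weight_ge i (x - y).
Proof.
move=> wx wy j ji.
by rewrite (coordinateD ce) (coordinateN ce) wx // wy // subrr.
Qed.

Lemma weight_geD i x y : weight_ge i x -> weight_ge i y -> weight_ge i (x + y).
Proof. by move=> wx wy j ji; rewrite (coordinateD ce) wx // wy // addr0. Qed.

Lemma weight_geZ i a x : weight_ge i x -> weight_ge i (a *: x).
Proof. by move=> wx j ji; rewrite (coordinateZ ce) wx // mulr0. Qed.

Hypothesis graded : forall i v w, weight_ge i w -> weight_ge i.+1 (mul2 v w).

Lemma coordinate_is_derive j (f : R -> V) (df : V) t :
  is_derive t (1 : R) f df -> is_derive t (1 : R) (c j \o f) (c j df).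
Proof.
move=> [Df <-]; have dft : differentiable f t by exact/derivable1_diffP.
split; first exact/diff_derivable/(coordinate_differentiable ce).
have := coordinate_dder ce j (1 : R) dft.
by rewrite !dderE => <-.
Qed.

(** Coordinatewise integration of the equation of [is_derive_ray_form]: brackets
    raise weights, so they do not contribute to the leading part. *)
Lemma ray_form_leading i v w t : weight_ge i w ->
  weight_ge i.+1 (ray_form v w t - t *: w).
Proof.
move=> wi.
have dj j s := coordinate_is_derive j (is_derive_ray_form v w s).
have f0 : ray_form v w 0 = 0.
  rewrite /ray_form !scale0r oppr0.
  exact: (linear_fun0 (dder_dir_linear (smooth_differentiable 0 (smooth_left 0)))).
have lower k : (k <= i)%N -> forall s, weight_ge k (ray_form v w s).
  elim: k => [//|k IH] ki s j jk.
  have -> : c j (ray_form v w s) = (c j \o ray_form v w) 0.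
    apply: (@is_derive_0_is_cst _ (c j \o ray_form v w)).
    move=> u; have := dj j u.
    rewrite (coordinateD ce) (coordinateN ce) (coordinateZ ce).
    rewrite wi; last exact: leq_trans ki.
    by rewrite (graded v (IH (ltnW ki) u)) // mulr0 subr0.
  by rewrite /= f0 (coordinate0 ce).
move=> j ji; pose F s := ray_form v w s - s *: w.
have -> : c j (ray_form v w t - t *: w) = (c j \o F) 0.
  apply: (@is_derive_0_is_cst _ (c j \o F)) => u.
  have := coordinate_is_derive j
    (is_deriveB (is_derive_ray_form v w u) (is_derive_line w u)).
  rewrite addrAC subrr sub0r (coordinateN ce) (coordinateZ ce).
  by rewrite (graded v (lower i (leqnn i) u)) // mulr0 oppr0.
by rewrite /= /F f0 scale0r subrr (coordinate0 ce).
Qed.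

(** Left translations are unipotent: the Maurer-Cartan form has this property by
    [ray_form_leading], hence so does its inverse, and every differential of a
    left translation is a product of the two. *)
Lemma mcform_leading i x p : weight_ge i p -> weight_ge i.+1 (mcform x p - p).
Proof.
by move=> pi; have := ray_form_leading x 1 pi; rewrite /ray_form !scale1r.
Qed.

Lemma mcformK x p : mcform x (lfield p x) = p.
Proof.
have dl y z := smooth_differentiable z (smooth_left y).
have := dder_comp p (dl x 0) (dl (- x) _).
rewrite explawx0 /mcform /lfield => <-.
rewrite (_ : _ \o _ = id) ?dder_id //.
by apply/funext => y /=; exact: explawNK.
Qed.

(** By induction on the weight: if [lfield p x] has weight at least [k], then
    [mcform_leading] applies to it and [mcformK] bounds its difference with [p]. *)
Lemma lfield_leading i x p : weight_ge i p -> weight_ge i.+1 (lfield p x - p).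
Proof.
move=> wp; suff lower k : (k <= i)%N -> weight_ge k (lfield p x).
  rewrite -{2}(mcformK x p) -opprB -scaleN1r.
  exact/weight_geZ/mcform_leading/lower.
elim: k => [//|k IH] ki.
have := mcform_leading x (IH (ltnW ki)); rewrite mcformK => H.
rewrite -[lfield p x](subKr p).
by apply: weight_geB => //; exact: weight_ge_le wp.
Qed.

Lemma dder_left_leading i x y p :
  weight_ge i p -> weight_ge i.+1 (dder p (mul y) x - p).
Proof.
move=> wp; have dl z w := smooth_differentiable w (smooth_left z).
have -> : dder p (mul y) x = lfield (mcform x p) (mul y x).
  have := dder_comp p (dl (- x) x) (dl (mul y x) _).
  rewrite explawNx /lfield /mcform => <-; suff -> : mul (mul y x) \o mul (- x) = mul y by [].
  by apply/funext => z; rewrite /= -(explawA mulP) explawKN.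
have wE := mcform_leading x wp.
rewrite -(subrKA (mcform x p)); apply: weight_geD => //.
apply: lfield_leading; rewrite -[mcform x p](subrK p).
by apply: weight_geD => //; exact: weight_ge_le wE.
Qed.

(** The difference with [s *: p] has zero derivative in the coordinates of weight
    at most [i] along the segment from [x] to [x + p]. *)
Lemma left_leading i y x p :
  weight_ge i p -> weight_ge i.+1 (mul y (x + p) - mul y x - p).
Proof.
move=> wp j ji; pose F s := mul y (s *: p + x) - s *: p.
have -> : mul y (x + p) - mul y x - p = F 1 - F 0.
  by rewrite /F !scale1r scale0r add0r subr0 [x + p]addrC addrAC.
rewrite (coordinateD ce) (coordinateN ce).
suff -> : c j (F 1) = c j (F 0) by rewrite subrr.
apply: (@is_derive_0_is_cst _ (c j \o F)) => u.
have dl z w := smooth_differentiable w (smooth_left z).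
have dline : differentiable (fun s : R => s *: p + x) u by exact: differentiableD.
have Dl : is_derive u (1 : R) (fun s => mul y (s *: p + x)) (dder p (mul y) (u *: p + x)).
  split; first exact/diff_derivable/(differentiable_comp dline (dl _ _)).
  rewrite (_ : 'D_1 _ u = dder (1 : R) (fun s => mul y (s *: p + x)) u);
    last by rewrite dderE.
  by apply: dder_along => h; rewrite [h *: 1]mulr1 scalerDl addrA.
have := coordinate_is_derive j (is_deriveB Dl (is_derive_line p u)).
by rewrite (dder_left_leading _ _ wp).
Qed.

End graded.
End exponential_law.

(** * Left translations of Carnot groups *)

Section carnot_group_calculus.
Context {R : realType} {m r : nat} (G : carnot_group R m r).
Local Notation V := 'rV[R]_(m + r).
Local Notation mul := (cmul G).
Local Notation d := (weight G).

Let e (j : 'I_(m + r)) : V := delta_mx 0 j.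
Let c (j : 'I_(m + r)) (v : V) : R := v ord0 j.

Let ce : linear_coordinates e c.
Proof.
split=> [v|j x]; first exact: row_sum_delta.
have dc : differentiable (c j) x by exact: differentiable_coord.
split=> // v.
have -> : 'D_v (c j) x = 'D_v (fun y : V => y) x ord0 j.
  rewrite derive_mx; last exact: derivable_id.
  by rewrite mxE.
by rewrite derive_id.
Qed.

Let cmulP : exponential_law mul.
Proof.
by split; [exact: cmulA|exact: cmul0x|exact: cmul_smooth|exact: cmul_ray].
Qed.

Lemma lie_bracketE p q : lie_bracket mul p q = 2 *: mul2 mul p q.
Proof.
have E z : left_invariant_field mul z = lfield mul z.
  by apply/funext => x; rewrite /left_invariant_field /lfield dderE.
have E2 p' q' : 'D_p' (lfield mul q') 0 = mul2 mul p' q' by rewrite /mul2 dderE.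
rewrite /lie_bracket /vector_field_bracket !E !(lfield0 cmulP) !E2.
by rewrite [mul2 _ q p](mul2C cmulP) opprK scaler_nat mulr2n.
Qed.

Lemma layerD i (x y : V) : layer d i x -> layer d i y -> layer d i (x + y).
Proof. by move=> lx ly j ji; rewrite mxE lx // ly // addr0. Qed.

Lemma layerZ i a (x : V) : layer d i x -> layer d i (a *: x).
Proof. by move=> lx j ji; rewrite mxE lx // mulr0. Qed.

Lemma mul2_layer1 i (a b : V) : (1 <= i)%N -> layer d 1 a -> layer d i b ->
  layer d i.+1 (mul2 mul a b).
Proof.
move=> i1 la lb.
have : layer d i.+1 (lie_bracket mul a b).
  rewrite -(stratification G i1).
  exists 1%N, (fun=> 1), (fun=> a), (fun=> b); split=> //.
  by rewrite big_ord1 scale1r.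
rewrite lie_bracketE => /(layerZ 2^-1).
by rewrite scalerA mulVf ?scale1r // pnatr_eq0.
Qed.

(** The bracket is additive on weights: by stratification for the first layer,
    and by the Jacobi identity for the brackets that span the next ones. *)
Lemma mul2_layer i j (v w : V) : (1 <= i)%N -> (1 <= j)%N ->
  layer d i v -> layer d j w -> layer d (i + j) (mul2 mul v w).
Proof.
case: i => // i _; elim: i j v w => [|i IH] j v w j1 lv lw.
  exact: mul2_layer1.
move: lv; rewrite -(stratification G (ltn0Sn i)) => -[n [k [a [b [ab ->]]]]].
have linl := mul2_linearl cmulP w.
rewrite (big_morph (mul2 mul ^~ w) (id1 := 0) (op1 := +%R)); first last.
- exact: (linear_fun0 linl).
- by move=> x y; exact: (linear_funD _ _ linl).
elim/big_ind: _ => [||l _].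
- by move=> ? _; rewrite mxE.
- by move=> x y; exact: layerD.
have [la lb] := ab l.
rewrite (linear_funZ _ _ linl) lie_bracketE (linear_funZ _ _ linl).
do 2 apply: layerZ.
rewrite (mul2_jacobi ce cmulP); apply: layerD.
  rewrite addSn; apply: mul2_layer1 => //.
  exact: IH.
rewrite -scaleN1r; apply: layerZ.
rewrite addSnnS; apply: IH => //.
exact: mul2_layer1.
Qed.

Lemma layer_basis j : layer d (d j) (e j).
Proof.
move=> k kj; rewrite mxE eqxx /=; case: eqP => // E.
by rewrite E eqxx in kj.
Qed.

(** Only the products of basis vectors [e k] and [e l] with [d l >= i] occur, and
    their weight [d k + d l] exceeds [i] since weights are positive. *)
Lemma mul2_graded i (v w : V) : weight_ge c d i w -> weight_ge c d i.+1 (mul2 mul v w).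
Proof.
move=> wi j ji; rewrite {1}[v](ce.1) {1}[w](ce.1).
have linl x := mul2_linearl cmulP x; have linr x := mul2_linearr cmulP x.
rewrite (big_morph (mul2 mul ^~ _) (id1 := 0) (op1 := +%R)); first last.
- exact: (linear_fun0 (linl _)).
- by move=> x y; exact: (linear_funD _ _ (linl _)).
rewrite /c summxE big1 // => k _; rewrite (linear_funZ _ _ (linl _)) mxE.
rewrite (big_morph (mul2 mul _) (id1 := 0) (op1 := +%R)); first last.
- exact: (linear_fun0 (linr _)).
- by move=> x y; exact: (linear_funD _ _ (linr _)).
rewrite summxE big1 ?mulr0 // => l _; rewrite (linear_funZ _ _ (linr _)) mxE.
case: (ltnP (d l) i) => li; first by rewrite -/(c l w) wi // mul0r.
have [/andP[k1 _] /andP[l1 _]] := (weight_step G k, weight_step G l).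
rewrite (mul2_layer k1 l1 (@layer_basis k) (@layer_basis l)) ?mulr0 //.
by rewrite neq_ltn (leq_trans ji) // -add1n leq_add.
Qed.

(** In exponential coordinates ordered by weight, a left translation is
    triangular with unit diagonal. *)
Lemma cmul_triangular (y x x' : V) (j : 'I_(m + r)) :
  (forall k : 'I_(m + r), (k < j)%N -> x ord0 k = x' ord0 k) ->
  mul y x' ord0 j - x' ord0 j = mul y x ord0 j - x ord0 j.
Proof.
move=> xx'; pose p := x' - x.
have wp : weight_ge c d (d j) p.
  move=> k kj; rewrite /c !mxE xx' ?subrr // ltnNge.
  by apply/negP => /(weight_nondecreasing G); rewrite leqNgt kj.
have := left_leading ce cmulP mul2_graded y x wp (ltnSn (d j)).
rewrite (_ : x + p = x'); last by rewrite /p addrC subrK.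
by rewrite /c /p !mxE => E; lra.
Qed.

(** Rays are one-parameter subgroups. *)
Lemma cinvE (x : V) : cinv G x = - x.
Proof.
by rewrite -[LHS](explawx0 cmulP) -[in LHS](explawxN cmulP x) cmulA cmulVx cmul0x.
Qed.

Lemma cmulKN (x y : V) : mul x (mul (- x) y) = y.
Proof. exact: explawKN cmulP _ _. Qed.

Lemma cmulNK (x y : V) : mul (- x) (mul x y) = y.
Proof. exact: explawNK cmulP _ _. Qed.

Lemma cmul_continuous : continuous (fun p : V * V => mul p.1 p.2).
Proof. exact/smooth_continuous/cmul_smooth. Qed.

End carnot_group_calculus.

(** * Lebesgue measure and triangular maps *)

Section affine_change_of_variable.
Context {R : realType}.
Local Notation leb := (@lebesgue_measure R).

Lemma measurable_affine (a c : R) : measurable_fun [set: measurableTypeR R]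
  (fun t : R => a * t + c : measurableTypeR R).
Proof. by apply: measurable_funD => //; exact: measurable_funM. Qed.

Let affine_image (a c : R) : {measure set (measurableTypeR R) -> \bar R} :=
  measure_function_pushforward__canonical__measure_function_Measure
    leb (measurable_affine a c).

Lemma lebesgue_affine (a c : R) (A : set (measurableTypeR R)) : 0 < a -> measurable A ->
  leb A = (a%:E * leb ((fun t : R => a * t + c)%R @^-1` A))%E.
Proof.
move=> a0 mA; pose k := NngNum (ltW a0).
rewrite (@lebesgue_measure_unique _ (mscale k (affine_image a c))) //.
move=> _ /ocitvP[->|[[x y] /= xy ->]]; first by rewrite !measure0.
rewrite /= /mscale /= /pushforward.
have -> : (fun t => a * t + c) @^-1` `]x, y]%classic =
    `](x - c) / a, (y - c) / a]%classic.
  apply/seteqP; split=> t; rewrite /= !in_itv /= ltr_pdivrMr // ler_pdivlMr //;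
    by rewrite [t * a]mulrC ltrBlDr lerBrDr.
have xy' : (x - c) / a < (y - c) / a by rewrite ltr_pM2r ?invr_gt0 // ltrD2r.
rewrite !lebesgue_measure_itv /= !lte_fin xy xy' -!EFinB -EFinM; congr EFin.
by field; rewrite gt_eqF.
Qed.

Lemma integral_affine (a c : R) (f : measurableTypeR R -> \bar R) : 0 < a ->
  measurable_fun setT f -> (forall t, 0 <= f t)%E ->
  (\int[leb]_t f t = a%:E * \int[leb]_t f (a * t + c)%R)%E.
Proof.
move=> a0 mf f0; pose k := NngNum (ltW a0).
have <- : (\int[affine_image a c]_t f t = \int[leb]_t f (a * t + c)%R)%E.
  exact: (ge0_integral_pushforward (measurable_affine a c) leb measurableT mf (fun t _ => f0 t)).
rewrite -(ge0_integral_mscale _ measurableT k) //.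
by apply: eq_measure_integral => A mA _; exact: lebesgue_affine.
Qed.

End affine_change_of_variable.

Section triangular_maps.
Context {R : realType}.
Local Notation leb := (@lebesgue_measure R).

(** The [j]-th coordinate of [f x] is [a j * x_j] plus a function of the previous
    coordinates of [x]. *)
Definition triangular n (a : 'I_n -> R) (f : 'rV[R]_n -> 'rV[R]_n) : Prop :=
  forall (x x' : 'rV[R]_n) (j : 'I_n),
    (forall k : 'I_n, (k < j)%N -> x ord0 k = x' ord0 k) ->
    f x' ord0 j - a j * x' ord0 j = f x ord0 j - a j * x ord0 j.

Lemma rV_cons0 n (t : R) (v : 'rV[R]_n) : rV_cons (t, v) ord0 ord0 = t.
Proof.
rewrite /rV_cons (_ : ord0 = @lshift 1 n ord0); last exact/val_inj.
by rewrite [LHS]row_mxEl mxE eqxx mulr1n.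
Qed.

Lemma rV_consS n (t : R) (v : 'rV[R]_n) j :
  rV_cons (t, v) ord0 (lift ord0 j) = v ord0 j.
Proof.
rewrite /rV_cons (_ : lift ord0 j = @rshift 1 n j); last exact/val_inj.
by rewrite [LHS]row_mxEr.
Qed.

Lemma rV_cons_eta n (x : 'rV[R]_n.+1) :
  rV_cons (x ord0 ord0, \row_j x ord0 (lift ord0 j)) = x.
Proof.
apply/rowP => j; case: (unliftP ord0 j) => [k|] ->; last exact: rV_cons0.
by rewrite rV_consS mxE.
Qed.

Lemma lebesgue_rV_consE n (A : set 'rV[R]_n.+1) :
  lebesgue_rV R n.+1 A =
  (\int[leb]_t lebesgue_rV R n [set v | A (rV_cons (t, v))])%E.
Proof.
rewrite /= /rV_measure_cons /pushforward /product_measure1.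
apply: eq_integral => t _ /=; congr (lebesgue_rV R n _).
by apply/seteqP; split=> v; rewrite /xsection /= inE.
Qed.

Lemma measurable_rV_section n (A : set 'rV[R]_n.+1) : measurable A ->
  measurable_fun setT (fun t : measurableTypeR R =>
    lebesgue_rV R n [set v | A (rV_cons (t, v))]).
Proof.
move=> mA; have mB : measurable (@rV_cons R n @^-1` A).
  by rewrite -[X in measurable X]setTI; exact: measurable_rV_cons.
rewrite (_ : (fun t => _) = lebesgue_rV R n \o xsection (@rV_cons R n @^-1` A)).
  exact: measurable_fun_xsection.
apply/funext => t /=; congr (lebesgue_rV R n _).
by apply/seteqP; split=> v; rewrite /xsection /= inE.
Qed.

Lemma measurable_rV_cons_at n (t : R) :
  measurable_fun setT (fun v : 'rV[R]_n => rV_cons (t, v)).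
Proof.
apply: (measurableT_comp (@measurable_rV_cons R n)).
exact: (@measurable_fun_pair _ _ _ _ _ _ (cst (t : measurableTypeR R)) id).
Qed.

(** Fubini peels the first coordinate off: for fixed [t] the other coordinates of
    the map are again triangular, and the first one is affine in [t]. *)
Lemma lebesgue_rV_triangular n (a : 'I_n -> R) (f : 'rV[R]_n -> 'rV[R]_n) A :
  (forall j, 0 < a j) -> triangular a f -> measurable_fun setT f ->
  measurable A ->
  lebesgue_rV R n A = ((\prod_j a j)%:E * lebesgue_rV R n (f @^-1` A))%E.
Proof.
elim: n a f A => [|n IH] a f A a0 tf mf mA.
  rewrite big_ord0 mul1e; congr (lebesgue_rV R 0 _).
  by apply/seteqP; split=> x; rewrite /preimage /= [f x]thinmx0 [x]thinmx0.
pose c := f 0 ord0 ord0.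
have f1 x : f x ord0 ord0 = a ord0 * x ord0 ord0 + c.
  have : f x ord0 ord0 - a ord0 * x ord0 ord0 = c - a ord0 * (0 : 'rV[R]_n.+1) ord0 ord0.
    by apply: tf => k.
  by rewrite mxE mulr0 subr0 => /eqP; rewrite subr_eq addrC => /eqP.
pose F t v : 'rV[R]_n := \row_j f (rV_cons (t, v)) ord0 (lift ord0 j).
have fE t v : f (rV_cons (t, v)) = rV_cons (a ord0 * t + c, F t v).
  by rewrite -[LHS]rV_cons_eta f1 rV_cons0.
rewrite !lebesgue_rV_consE.
pose g t := lebesgue_rV R n [set v | A (rV_cons (t, v))].
rewrite (@integral_affine _ (a ord0) c g) //; last exact: measurable_rV_section.
rewrite big_ord_recl EFinM -muleA; congr (_ * _)%E.
rewrite -ge0_integralZl //; last 2 first.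
- apply: measurable_rV_section.
  by rewrite -[X in measurable X]setTI; exact: mf.
- by rewrite lee_fin prodr_ge0 // => j _; exact: ltW.
apply: eq_integral => t _.
rewrite /g (IH (fun j => a (lift ord0 j)) (F t)) //.
- congr (_ * lebesgue_rV R n _)%E.
  by apply/seteqP; split=> v; rewrite /= /preimage /= fE.
- move=> x x' j xx'; rewrite !mxE.
  have := tf (rV_cons (t, x)) (rV_cons (t, x')) (lift ord0 j).
  rewrite !rV_consS; apply => k; case: (unliftP ord0 k) => [l|] ->.
    by rewrite !rV_consS => lj; apply: xx'.
  by rewrite !rV_cons0.
- apply: measurable_fun_rVP => j.
  rewrite [X in measurable_fun _ X](_ : _ =
    (fun x : 'rV[R]_n.+1 => x ord0 (lift ord0 j) : measurableTypeR R) \o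
    (f \o (fun v => rV_cons (t, v)))).
    apply: measurableT_comp; first exact: measurable_coord.
    by apply: measurableT_comp => //; exact: measurable_rV_cons_at.
  by apply/funext => v /=; rewrite mxE.
- rewrite -[X in measurable X]setTI.
  by apply: (@measurable_rV_cons_at n (a ord0 * t + c)).
Qed.

End triangular_maps.

(** * Borel sets of coordinate spaces *)

Section borel_rV.
Context {R : realType}.

Lemma measurable_rV_box n (q : 'rV[R]_n) (e : R) :
  measurable [set x : 'rV[R]_n | forall j, `|q ord0 j - x ord0 j| < e].
Proof.
rewrite (_ : [set x | _] = \bigcap_(j in [set: 'I_n])
    ((fun x : 'rV[R]_n => x ord0 j : measurableTypeR R) @^-1` ball (q ord0 j) e)).
  apply: fin_bigcap_measurable => // j _.
  rewrite -[X in measurable X]setTI.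
  by apply: measurable_coord => //; exact: measurable_ball.
by apply/seteqP; split=> x /= H j; [move=> _|]; have := H j; rewrite -ball_normE; apply.
Qed.

(** Rational boxes form a countable basis. *)
Lemma open_measurable_rV n (U : set 'rV[R]_n) : open U -> measurable U.
Proof.
move=> oU; pose box (q : 'rV[rat]_n) (k : nat) : set 'rV[R]_n :=
  [set x | forall j, `|ratr (q ord0 j) - x ord0 j| < k.+1%:R^-1].
pose F (i : nat) : set 'rV[R]_n :=
  if unpickle i is Some (q, k) then
    if `[< box q k `<=` U >] then box q k else set0 else set0.
rewrite (_ : U = \bigcup_i F i).
  apply: bigcupT_measurable => i; rewrite /F; case: unpickle => // -[q k].
  case: asboolP => // _.
  rewrite (_ : box q k = [set x | forall j,
    `|(map_mx ratr q : 'rV[R]_n) ord0 j - x ord0 j| < k.+1%:R^-1]).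
    exact: measurable_rV_box.
  by apply/seteqP; split=> x /= H j; have := H j; rewrite mxE.
apply/seteqP; split=> [x Ux|x [i _]]; last first.
  by rewrite /F; case: unpickle => // -[q k]; case: asboolP => // sub; apply: sub.
have /nbhs_ballP[e /= e0 eU] : nbhs x U by apply: open_nbhs_nbhs.
have [k _ /(_ k (leqnn k)) ke] := near_infty_natSinv_lt (PosNum (divr_gt0 e0 (ltr0n R 2))).
have [q qx] : {q : 'rV[rat]_n & forall j, `|ratr (q ord0 j) - x ord0 j| < k.+1%:R^-1}.
  have H (j : 'I_n) : {q : rat | `|ratr q - x ord0 j| < k.+1%:R^-1}.
    apply: cid; have k0 : 0 < k.+1%:R^-1 :> R by rewrite invr_gt0.
    have /rat_in_itvoo[q] : x ord0 j - k.+1%:R^-1 < x ord0 j + k.+1%:R^-1.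
      by rewrite ltrBlDr -addrA ltrDl addr_gt0.
    by rewrite in_itv /= => ?; exists q; rewrite ltr_distl.
  by exists (\row_j sval (H j)) => j; rewrite mxE; exact: (svalP (H j)).
exists (pickle (q, k)) => //; rewrite /F pickleK.
case: asboolP => // nsub; exfalso; apply: nsub => y qy; apply: eU.
split => // i j; rewrite (ord1 i) -ball_normE /=.
rewrite -(subrKA (ratr (q ord0 j))) (le_lt_trans (ler_normD _ _)) //.
by rewrite (splitr e) distrC ltrD // (lt_trans (_ : _ < k.+1%:R^-1)).
Qed.

Lemma continuous_measurable_rV n (f : 'rV[R]_n -> R) :
  continuous f -> measurable_fun setT (f : 'rV[R]_n -> measurableTypeR R).
Proof.
move=> /continuousP cf; apply: (measurability _ (RGenOpens.measurableE R)).
move=> _ [_ [a [b ->] <-]]; rewrite setTI; apply: open_measurable_rV.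
exact/cf/interval_open.
Qed.

(** Concatenating the coordinates identifies the product with one coordinate
    space, in a way which is both measurable and continuous. *)
Lemma continuous_measurable_rV2 n (f : 'rV[R]_n * 'rV[R]_n -> R) :
  continuous f -> measurable_fun setT (f : _ -> measurableTypeR R).
Proof.
move=> cf; pose s (z : 'rV[R]_(n + n)) := (lsubmx z, rsubmx z).
have cs : continuous s.
  move=> z; apply: differentiable_continuous; apply: differentiable_pair.
    exact: differentiable_lsubmx.
  exact: differentiable_rsubmx.
rewrite (_ : f = (f \o s) \o (fun p : 'rV[R]_n * 'rV[R]_n => row_mx p.1 p.2)).
  apply: measurableT_comp.
    apply: continuous_measurable_rV => z; apply: continuous_comp; [exact: cs|exact: cf].
  apply: measurable_fun_rVP => i; case: (split_ordP i) => j ->.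
    rewrite [X in measurable_fun _ X](_ : _ =
      (fun x : 'rV[R]_n => x ord0 j : measurableTypeR R) \o fst).
      by apply: measurableT_comp; [exact: measurable_coord|exact: measurable_fst].
    by apply/funext => p /=; rewrite row_mxEl.
  rewrite [X in measurable_fun _ X](_ : _ =
    (fun x : 'rV[R]_n => x ord0 j : measurableTypeR R) \o snd).
    by apply: measurableT_comp; [exact: measurable_coord|exact: measurable_snd].
  by apply/funext => p /=; rewrite row_mxEr.
by apply/funext => -[x y]; rewrite /= /s row_mxKl row_mxKr.
Qed.

Lemma continuous_measurable_rV_map n (f : 'rV[R]_n -> 'rV[R]_n) :
  continuous f -> measurable_fun setT f.
Proof.
move=> cf; apply: measurable_fun_rVP => j.
apply: (@continuous_measurable_rV _ (fun x => f x ord0 j)) => x.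
exact: (continuous_comp (cf x) (@coord_continuous _ _ _ ord0 j (f x))).
Qed.

Lemma lebesgue_rV_cube n :
  (lebesgue_rV R n [set x : 'rV[R]_n | forall j, (`|x ord0 j| < 1)%R] < +oo)%E.
Proof.
elim: n => [|n IH].
  by rewrite /= /dirac /= indicE ltry.
rewrite /= /rV_measure_cons /pushforward.
rewrite (_ : _ @^-1` _ = `]-1, 1[%classic `*` [set x : 'rV[R]_n | forall j, `|x ord0 j| < 1]).
  rewrite product_measure1E //.
    have L : (@lebesgue_measure R `](-1)%R, 1%R[%classic < +oo)%E.
      by rewrite lebesgue_measure_itv /= -EFinB; case: ifP => _; exact: ltry.
    by apply: lte_mul_pinfty => //; rewrite ge0_fin_numE.
  rewrite (_ : [set x : 'rV[R]_n | _] = [set x | forall j, `|(0 : 'rV[R]_n) ord0 j - x ord0 j| < 1]).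
    exact: measurable_rV_box.
  by apply/seteqP; split=> x /= H j; have := H j; rewrite mxE sub0r normrN.
apply/seteqP; split=> [[t v] /= H|[t v] /= [+ H] j].
  split; first by have := H ord0; rewrite rV_cons0 in_itv /= ltr_norml.
  by move=> j; have := H (lift ord0 j); rewrite rV_consS.
rewrite in_itv /= -ltr_norml => t1.
by case: (unliftP ord0 j) => [k|] ->; rewrite ?rV_cons0 ?rV_consS.
Qed.

End borel_rV.

(** * Volume of the balls of a homogeneous norm *)

Section homogeneous_balls.
Context {R : realType} {m r : nat} (G : carnot_group R m r).
Local Notation V := 'rV[R]_(m + r).
Local Notation leb := (lebesgue_rV R (m + r)).
Local Notation Q := (homogeneous_dim G).

Lemma homogeneous_dimE : Q = (\sum_j weight G j)%N.
Proof.
rewrite /homogeneous_dim /layer_dim.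
under eq_bigr do rewrite -sum1_card big_distrr /=.
under eq_bigr do rewrite big_mkcond /=.
rewrite exchange_big /=; apply: eq_bigr => j _.
have /andP[j1 js] := weight_step G j.
rewrite (bigD1_seq (weight G j)) /=.
- rewrite unfold_in eqxx muln1 big1_seq ?addn0 // => i /andP[ij _].
  by rewrite unfold_in eq_sym (negbTE ij).
- by rewrite mem_index_iota j1 ltnS.
- exact: iota_uniq.
Qed.

Lemma lebesgue_cmul (y : V) A : measurable A -> leb (cmul G y @^-1` A) = leb A.
Proof.
move=> mA; rewrite [RHS](@lebesgue_rV_triangular _ _ (fun=> 1) (cmul G y)) //.
- by rewrite big1 // mul1e.
- by move=> x x' j xx'; rewrite !mul1r; exact: cmul_triangular.
- apply: continuous_measurable_rV_map => x.
  have := @cmul_continuous _ _ _ G (y, x).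
  apply: (@continuous_comp _ _ _ (fun x => (y, x)) (fun p : V * V => cmul G p.1 p.2)).
  by apply: differentiable_continuous; exact: differentiable_pair.
Qed.

Lemma derivable_dilation (x : V) t : derivable (fun l : R => dilation G l x) t 1.
Proof.
apply/derivable_mxP => i j.
rewrite (_ : (fun l => _) = (fun l : R => l ^+ weight G j * x ord0 j)); last first.
  by apply/funext => l; rewrite mxE.
by apply: derivableM => //; exact: exprn_derivable.
Qed.

Lemma lebesgue_dilation (l : R) A : 0 < l -> measurable A ->
  leb A = ((l ^+ Q)%:E * leb (dilation G l @^-1` A))%E.
Proof.
move=> l0 mA.
rewrite (@lebesgue_rV_triangular _ _ (fun j => l ^+ weight G j) (dilation G l)) //.
- by rewrite homogeneous_dimE prodrXr.
- by move=> j; exact: exprn_gt0.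
- by move=> x x' j _; rewrite !mxE !subrr.
- apply: measurable_fun_rVP => j.
  rewrite [X in measurable_fun _ X](_ : _ =
    (fun x : V => l ^+ weight G j * x ord0 j : measurableTypeR R)).
    by apply: measurable_funM => //; exact: measurable_coord.
  by apply/funext => x; rewrite mxE.
Qed.

Context (N : V -> R) (hN : is_homogeneous_norm G N).

Lemma measurable_hnorm : measurable_fun setT (N : V -> measurableTypeR R).
Proof. by apply: continuous_measurable_rV; exact: hnorm_continuous hN. Qed.

Lemma measurable_hnorm_ball (t : R) : measurable [set x | N x < t].
Proof.
rewrite (_ : [set x | N x < t] = setT `&` (N @^-1` `]-oo, t[)).
  by apply: measurable_hnorm => //; exact: measurable_itv.
by rewrite setTI; apply/seteqP; split=> x; rewrite /= in_itv.
Qed.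

Lemma lebesgue_ball0 (t : R) : 0 < t ->
  leb [set x | N x < t] = ((t ^+ Q)%:E * ball_volume N)%E.
Proof.
move=> t0; rewrite (@lebesgue_dilation t) //; last exact: measurable_hnorm_ball.
congr (_ * leb _)%E; apply/seteqP; split=> x /=;
  by rewrite (hnorm_dilation hN) // gtr_pMr.
Qed.

Lemma lebesgue_ball (y : V) (t : R) : 0 < t ->
  leb [set x | N (cmul G (cinv G y) x) < t] = ((t ^+ Q)%:E * ball_volume N)%E.
Proof.
move=> t0; rewrite -lebesgue_ball0 // -[RHS](@lebesgue_cmul (cinv G y)) //.
exact: measurable_hnorm_ball.
Qed.

(** By compactness [N] has a positive minimum [c] on the unit sphere of the
    sup norm, so the ball of radius [c] lies in a cube; rescale. *)
Lemma ball_volume_fin : (ball_volume N < +oo)%E.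
Proof.
pose S : set V := [set x | `|x| = 1].
have [j0 _] := last_layer G.
have nE (x : V) j : `|x ord0 j| <= `|x|.
  by rewrite [leRHS]/Num.Def.normr /= mx_normrE; apply: (le_bigmax _ (fun i => `|x i.1 i.2|) (ord0, j)).
have S0 : S !=set0.
  exists (const_mx 1); rewrite /S /=; apply/eqP; rewrite eq_le; apply/andP; split.
    rewrite [leLHS]/Num.Def.normr /= mx_normrE; apply/bigmax_leP; split=> // i _.
    by rewrite mxE normr1.
  by have := nE (const_mx 1) j0; rewrite mxE normr1.
have cS : compact S.
  apply: bounded_closed_compact.
    exists 1; split=> // M M1 x /= ->; exact: ltW.
  rewrite (_ : S = (fun x : V => `|x|) @^-1` [set 1]).
    apply: closed_comp; last exact: closed_eq.
    by move=> x _; exact: norm_continuous.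
  by [].
have [x0 x0S min0] := EVT_min_rV S0 cS (continuous_subspaceT (hnorm_continuous hN)).
have c0 : 0 < N x0.
  rewrite lt_neqAle (hnorm_ge0 hN) andbT eq_sym; apply/eqP => /(hnorm_eq0 hN) E.
  by move: x0S; rewrite E inE /S /= normr0 => /esym/eqP; rewrite oner_eq0.
have sub : [set x | N x < N x0] `<=` [set x : V | forall j, `|x ord0 j| < 1].
  move=> x /= Nx j; apply: (le_lt_trans (nE x j)); rewrite ltNge; apply/negP => x1.
  pose g (l : R) := `|dilation G l x|.
  have cg : {within `[0, 1], continuous g}.
    apply: continuous_subspaceT => t.
    apply: (@continuous_comp _ _ _ (fun l => dilation G l x) Num.norm).
      exact/differentiable_continuous/derivable1_diffP/derivable_dilation.
    exact: norm_continuous.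
  have g0 : g 0 = 0.
    rewrite /g (_ : dilation G 0 x = 0) ?normr0 //; apply/rowP => i; rewrite !mxE.
    by have /andP[i1 _] := weight_step G i; rewrite expr0n gtn_eqF // mul0r.
  have g1 : g 1 = `|x|.
    by congr Num.norm; apply/rowP => i; rewrite mxE expr1n mul1r.
  have [l l01 gl] : exists2 l, l \in `[0, 1] & g l = 1.
    by apply: IVT; rewrite ?g0 ?g1 ?ler01 // ge_min le_max ler01 x1 orbT.
  have l0 : 0 < l.
    move: l01; rewrite in_itv /= le_eqVlt => /andP[/orP[/eqP l0|//] _].
    by move: gl; rewrite -l0 g0 => /esym/eqP; rewrite oner_eq0.
  have := min0 (dilation G l x); rewrite inE => /(_ gl).
  rewrite (hnorm_dilation hN) // leNgt => /negP; apply; apply: le_lt_trans Nx.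
  by rewrite ler_piMl ?(hnorm_ge0 hN) //; move: l01; rewrite in_itv /= => /andP[].
have : (leb [set x | N x < N x0]%R < +oo)%E.
  apply: le_lt_trans (lebesgue_rV_cube (m + r)); apply: le_measure => //.
  - by rewrite inE; exact: measurable_hnorm_ball.
  - rewrite inE (_ : [set x : V | _] =
      [set x | forall j, `|(0 : V) ord0 j - x ord0 j| < 1]).
      exact: measurable_rV_box.
    by apply/seteqP; split=> x /= H j; have := H j; rewrite mxE sub0r normrN.
rewrite lebesgue_ball0 //; rewrite !ltey; apply: contraNN => /eqP ->.
by rewrite gt0_muley // lte_fin exprn_gt0.
Qed.

(** [y^-1 x] and [x^-1 y] are mutually inverse. *)
Lemma hnorm_dist_sym x y : N (cmul G (cinv G y) x) = N (cmul G (cinv G x) y).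
Proof.
rewrite -(hnorm_inv hN) !cinvE.
set a := cmul G (- y) x; set b := cmul G (- x) y.
have ab : cmul G a b = 0.
  by rewrite -cmulA cmulKN -(cinvE G) cmulVx.
have aN : cmul G a (- a) = 0 by have := cmulVx G (- a); rewrite cinvE opprK.
by rewrite -[in LHS](cmulNK G a (- a)) aN -[in RHS](cmulNK G a b) ab.
Qed.

Lemma measurable_hnorm_dist : measurable_fun setT
  (fun p : V * V => N (cmul G (cinv G p.2) p.1) : measurableTypeR R).
Proof.
apply: (@continuous_measurable_rV2 _ _ (fun p => N (cmul G (cinv G p.2) p.1))).
move=> p; apply: (@continuous_comp _ _ _ (fun p : V * V => cmul G (cinv G p.2) p.1) N);
  last exact: (hnorm_continuous hN).
apply: (@continuous_comp _ _ _ (fun p : V * V => (cinv G p.2, p.1))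
  (fun q : V * V => cmul G q.1 q.2)); last exact: cmul_continuous.
have -> : (fun p : V * V => (cinv G p.2, p.1)) = (fun p => (- p.2, p.1)).
  by apply/funext => q; rewrite cinvE.
have cN : -%R (q : V) @[q --> nbhs p.2] --> - p.2 by exact: opp_continuous.
exact: cvg_pair (cvg_comp _ _ cvg_snd cN) cvg_fst.
Qed.

End homogeneous_balls.

(** * Growth of Orlicz functions *)

Section orlicz_function.
Context {R : realType} (phi : R -> R) (pm pp : R) (hphi : is_orlicz phi pm pp).
Local Notation leb := (@lebesgue_measure R).
Local Notation Phi := (orlicz_fun phi).

Lemma orlicz_density_ge0 s : 0 <= s -> 0 <= phi s.
Proof.
by move=> s0; rewrite -(orlicz_density0 hphi); exact: (orlicz_density_nondecreasing hphi).
Qed.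

(** [phi] is only monotone on [[0, +oo[]; extending it by a constant to the left
    makes it monotone, hence measurable, on the line. *)
Lemma orlicz_density_integrable t :
  leb.-integrable `[0, t]%classic (EFin \o phi).
Proof.
pose psi s := phi (Num.max s 0).
have psi_nd : nondecreasing_fun psi.
  move=> a b ab; apply: (orlicz_density_nondecreasing hphi).
    by rewrite le_max lexx orbT.
  by rewrite ge_max !le_max ab lexx orbT.
have E s : s \in (`[0, t]%classic : set R) -> psi s = phi s.
  by rewrite inE /= in_itv /= /psi => /andP[s0 _]; rewrite max_l.
have psi_int : leb.-integrable `[0, t]%classic (EFin \o psi).
  apply: measurable_bounded_integrable => //.
  - by rewrite /= lebesgue_measure_itv /= -EFinB; case: ifP => _; exact: ltry.
  - exact: nondecreasing_measurable.
  - exists (psi t); split=> [|M M1 s /=]; first exact: num_real.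
    rewrite in_itv /= => /andP[s0 st].
    rewrite ger0_norm; first by apply: le_trans (ltW M1); exact: psi_nd.
    by apply: orlicz_density_ge0; rewrite le_max lexx orbT.
by apply: eq_integrable psi_int => // s st /=; rewrite E.
Qed.

Lemma orlicz_fun_increment a b : 0 <= a -> a <= b ->
  phi a * (b - a) <= Phi b - Phi a <= phi b * (b - a).
Proof.
move=> a0 ab; rewrite /orlicz_fun Rintegral_itvB; first last.
- by rewrite bnd_simp.
- by rewrite bnd_simp.
- exact: orlicz_density_integrable.
have mab : (leb `]a, b]%classic = (b - a)%:E)%E.
  rewrite lebesgue_measure_itv /= lte_fin; case: ltrP => // ba.
  by rewrite (_ : b = a) ?subrr //; apply/eqP; rewrite eq_le ba.
have cst_int c : leb.-integrable `]a, b]%classic (EFin \o cst c).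
  apply: measurable_bounded_integrable => //; first by rewrite /= mab ltry.
  by exists `|c|; split=> [|M /ltW cM s _]; [exact: num_real|exact: cM].
have phi_int : leb.-integrable `]a, b]%classic (EFin \o phi).
  apply: integrableS (orlicz_density_integrable b) => //.
  by move=> s /=; rewrite !in_itv /= => /andP[sa ->]; rewrite (ltW (le_lt_trans a0 sa)).
have cstE c : c * (b - a) = \int[leb]_(s in `]a, b]) c.
  rewrite Rintegral_cst //; exact: (congr1 (fun x => c * fine x) (esym mab)).
rewrite !cstE; apply/andP; split.
  apply: (le_Rintegral _ (cst_int (phi a)) phi_int) => // s.
  rewrite /= in_itv /= => /andP[sa sb].
  by apply: (orlicz_density_nondecreasing hphi) => //; exact: ltW.
apply: (le_Rintegral _ phi_int (cst_int (phi b))) => // s.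
rewrite /= in_itv /= => /andP[sa sb].
by apply: (orlicz_density_nondecreasing hphi) => //; exact: le_trans (ltW sa).
Qed.

(** Convexity of the Orlicz function, whose density [phi] is nondecreasing. *)
Lemma orlicz_fun_subgradient a b : 0 <= a -> 0 <= b ->
  Phi a + (b - a) * phi a <= Phi b.
Proof.
move=> a0 b0; have [ab|/ltW ba] := leP a b.
  by have /andP[+ _] := orlicz_fun_increment a0 ab; lra.
by have /andP[_ +] := orlicz_fun_increment b0 ba; lra.
Qed.

Lemma orlicz_fun0 t : t <= 0 -> Phi t = 0.
Proof.
rewrite le_eqVlt => /predU1P[->|t0]; rewrite /orlicz_fun.
  by rewrite set_itv1 Rintegral_set1.
by rewrite set_itv_ge ?Rintegral_set0 // bnd_simp -ltNge.
Qed.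

Lemma orlicz_fun_ge0 t : 0 <= Phi t.
Proof.
apply: Rintegral_ge0 => s /=; rewrite in_itv /= => /andP[s0 _].
exact: orlicz_density_ge0.
Qed.

Lemma orlicz_fun_nd : nondecreasing_fun Phi.
Proof.
move=> a b ab; have [a0|a0] := leP 0 a; last by rewrite orlicz_fun0 ?orlicz_fun_ge0 // ltW.
have /andP[H _] := orlicz_fun_increment a0 ab.
rewrite -subr_ge0; apply: le_trans H.
by rewrite mulr_ge0 ?orlicz_density_ge0 // subr_ge0.
Qed.

Lemma measurable_orlicz_fun : measurable_fun setT Phi.
Proof. by apply: nondecreasing_measurable => //; exact: orlicz_fun_nd. Qed.

Lemma orlicz_exponents_gt0 : 0 < pm /\ 0 < pp.
Proof.
have pm0 : 0 < pm := lt_trans ltr01 (orlicz_exponent_gt1 hphi).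
by split=> //; exact: lt_le_trans (orlicz_exponent_le hphi).
Qed.

Lemma orlicz_fun_gt0 t : 0 < t -> 0 < Phi t.
Proof.
move=> t0; rewrite lt_neqAle orlicz_fun_ge0 andbT eq_sym; apply/eqP => E.
have /andP[+ _] := orlicz_growth hphi t0; rewrite E invr0 mulr0.
by rewrite leNgt (proj1 orlicz_exponents_gt0).
Qed.

Lemma orlicz_density_bounds t : 0 < t -> pm * Phi t <= t * phi t <= pp * Phi t.
Proof.
move=> t0; have P0 := orlicz_fun_gt0 t0; move: (orlicz_growth hphi t0).
by rewrite ler_pdivlMr // ler_pdivrMr.
Qed.

(** Convexity at the midpoint of [2 * a] and [2 * b], in a form to be combined
    with doubling. *)
Lemma orlicz_fun_midpoint a b : 0 <= a -> 0 <= b ->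
  Phi (a + b) <= (Phi (2 * a) + Phi (2 * b)) / 2.
Proof.
move=> a0 b0; have ab : 0 <= a + b by exact: addr_ge0.
have := orlicz_fun_subgradient ab (mulr_ge0 (ler0n R 2) a0).
have := orlicz_fun_subgradient ab (mulr_ge0 (ler0n R 2) b0).
by move: (phi _) => p; lra.
Qed.

(** A multiplicative step [expR x]; the exponent of the growth hypothesis that
    applies depends on the sign of [x]. *)
Let exponent (x : R) : R := if 0 <= x then pm else pp.

(** The tangent at [t], with slope controlled by the growth hypothesis. *)
Lemma orlicz_fun_step x t : 0 <= t ->
  (1 + exponent x * x) * Phi t <= Phi (expR x * t).
Proof.
rewrite le_eqVlt => /predU1P[<-|t0]; first by rewrite mulr0 orlicz_fun0 // mulr0.
have ext : 0 <= expR x * t by rewrite mulr_ge0 ?expR_ge0 // ltW.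
apply: le_trans (orlicz_fun_subgradient (ltW t0) ext).
have /andP[H1 H2] := orlicz_density_bounds t0.
have ex := expR_ge1Dx x.
have A0 : 0 <= t * phi t by rewrite mulr_ge0 ?(ltW t0) ?orlicz_density_ge0 ?(ltW t0).
have -> : Phi t + (expR x * t - t) * phi t = Phi t + (expR x - 1) * (t * phi t) by ring.
rewrite mulrDl mul1r lerD2l; apply: (@le_trans _ _ (x * (t * phi t))); last first.
  by rewrite ler_wpM2r //; lra.
rewrite /exponent mulrAC mulrC; have [x0|/ltW x0] := leP 0 x.
  exact: ler_wpM2l.
exact: ler_wnM2l.
Qed.

Lemma orlicz_fun_steps n x t : 0 <= t -> 0 <= 1 + exponent x * x ->
  (1 + exponent x * x) ^+ n * Phi t <= Phi (expR (x *+ n) * t).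
Proof.
move=> t0 x1; elim: n => [|n IH]; first by rewrite expr0 mulr0n expR0 !mul1r.
have ent : 0 <= expR (x *+ n) * t by rewrite mulr_ge0 ?expR_ge0.
rewrite mulrS expRD -[expR x * _ * t]mulrA.
apply: le_trans (orlicz_fun_step x ent).
by rewrite exprS -mulrA ler_wpM2l.
Qed.

(** [1 + z >= expR (z / (1 + z))], so [n] steps of size [L / n] give at least
    [expR (p * L * n / (n + p * L))], and [n] tends to infinity. *)
Lemma orlicz_fun_expR L t : 0 <= t ->
  expR (exponent L * L) * Phi t <= Phi (expR L * t).
Proof.
rewrite le_eqVlt => /predU1P[<-|t0]; first by rewrite mulr0 orlicz_fun0 // mulr0.
set a := exponent L * L; have P0 := orlicz_fun_gt0 t0.
have PL0 : 0 < Phi (expR L * t) by apply: orlicz_fun_gt0; rewrite mulr_gt0 ?expR_gt0.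
rewrite -ler_pdivlMr // -[leRHS]lnK ?posrE ?divr_gt0 // ler_expR.
set l := ln _.
have step n : (0 < n)%N -> `|a| < n%:R -> a * n%:R <= l * (n%:R + a).
  move=> n0 an; have n0' : 0 < n%:R :> R by rewrite ltr0n.
  have na : 0 < n%:R + a by rewrite -ltrBlDr sub0r (le_lt_trans _ an) // -normrN ler_norm.
  have signE : exponent (L / n%:R) = exponent L.
    by rewrite /exponent pmulr_lge0 // invr_gt0.
  pose z := a / n%:R.
  have zE : exponent (L / n%:R) * (L / n%:R) = z by rewrite signE mulrA.
  have z1 : 0 < 1 + z by rewrite -(pmulr_lgt0 _ n0') mulrDl mul1r divfK ?gt_eqF.
  have := @orlicz_fun_steps n (L / n%:R) t (ltW t0).
  have -> : (L / n%:R) *+ n = L by rewrite -[LHS]mulr_natr divfK // gt_eqF.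
  rewrite zE => /(_ (ltW z1)).
  rewrite -ler_pdivlMr // => H.
  rewrite -ler_pdivrMr // -ler_expR lnK ?posrE ?divr_gt0 //.
  apply: le_trans H.
  have -> : a * n%:R / (n%:R + a) = (z / (1 + z)) *+ n.
    rewrite -[RHS]mulr_natr /z; field.
    by rewrite !gt_eqF.
  rewrite -[_ *+ n]mulr_natr expRM_natr.
  apply: lerXn2r; rewrite ?nnegrE ?expR_ge0 ?(ltW z1) //.
  rewrite -[leRHS]invrK -[leLHS]invrK lef_pV2 ?posrE ?invr_gt0 ?expR_gt0 // -expRN.
  apply: le_trans (expR_ge1Dx _).
  by rewrite le_eqVlt; apply/orP; left; apply/eqP; field; rewrite gt_eqF.
rewrite leNgt; apply/negP => la.
pose b := Num.max `|a| (l * a / (a - l)).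
have bn := archi_boundP (_ : 0 <= b).
have b0 : 0 <= b by rewrite le_max normr_ge0.
move: (bn b0); rewrite /b gt_max => /andP[an ln].
have n0 : (0 < Num.bound b)%N by rewrite -(ltr0n R) (le_lt_trans _ an).
have := step _ n0 an; rewrite leNgt => /negP; apply.
move: ln; rewrite ltr_pdivrMr ?subr_gt0 //; lra.
Qed.

(** The growth hypothesis bounds the logarithmic derivative of [Phi]; this is
    [orlicz_fun_expR] for the step from [t / x `^ q] up to [t]. *)
Lemma orlicz_fun_upper_power (x q t : R) : 1 <= x -> 0 <= q -> 0 <= t ->
  Phi (t / x `^ q) <= x `^ (- (q * pm)) * Phi t.
Proof.
move=> x1 q0 t0; have x0 : 0 < x by exact: lt_le_trans x1.
have L0 : 0 <= q * ln x by rewrite mulr_ge0 // ln_ge0.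
have pE : x `^ q = expR (q * ln x) by rewrite /powR gt_eqF.
have xq0 : 0 < x `^ q by exact: powR_gt0.
have := @orlicz_fun_expR (q * ln x) (t / x `^ q) (divr_ge0 t0 (ltW xq0)).
have tE : x `^ q * (t / x `^ q) = t by rewrite mulrC divfK ?gt_eqF.
rewrite /exponent L0 -pE tE.
have -> : expR (pm * (q * ln x)) = x `^ (q * pm).
  by rewrite /powR gt_eqF //; congr expR; ring.
by move=> H; rewrite powRN [leRHS]mulrC ler_pdivlMr ?powR_gt0 // mulrC.
Qed.

(** [orlicz_fun_expR] for the step from [t] down to [t / x `^ q]. *)
Lemma orlicz_fun_lower_power (x q t : R) : 1 <= x -> 0 <= q -> 0 <= t ->
  x `^ (- (q * pp)) * Phi t <= Phi (t / x `^ q).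
Proof.
move=> x1 q0 t0; have x0 : 0 < x by exact: lt_le_trans x1.
have L0 : 0 <= q * ln x by rewrite mulr_ge0 // ln_ge0.
have iE : (x `^ q)^-1 = expR (- (q * ln x)) by rewrite /powR gt_eqF // expRN.
have := @orlicz_fun_expR (- (q * ln x)) t t0.
rewrite -iE [_^-1 * t]mulrC; apply: le_trans; rewrite ler_wpM2r ?orlicz_fun_ge0 //.
rewrite /powR gt_eqF // ler_expR /exponent oppr_ge0.
have [qx|qx] := leP (q * ln x) 0; last by rewrite mulNr mulrAC mulrN mulrC.
have z : q * ln x = 0 by apply/eqP; rewrite eq_le qx.
by rewrite mulNr mulrAC z mul0r oppr0 mulr0.
Qed.

End orlicz_function.

(** * Integrals of powers of the distance *)

Section radial_integral.
Context {R : realType}.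
Local Notation leb := (@lebesgue_measure R).

Lemma powRN_cvg0 (p : R) : 0 < p -> x `^ (- p) @[x --> +oo] --> 0.
Proof.
move=> p0; apply/cvgr0Pnorm_lt => e e0; near=> x.
have y0 : 0 < e `^ (- p^-1) by exact: powR_gt0.
have x0 : e `^ (- p^-1) < x by near: x; apply: nbhs_pinfty_gt; exact: num_real.
have xp : 0 < x := lt_trans y0 x0.
rewrite ger0_norm ?powR_ge0 // powRN -[ltRHS]invrK ltf_pV2 ?posrE ?invr_gt0 ?powR_gt0 //.
have -> : e^-1 = (e `^ (- p^-1)) `^ p.
  by rewrite -powRrM mulNr mulVf ?gt_eqF // powR_inv1 // ltW.
by apply: gt0_ltr_powR; rewrite // ?nnegrE ltW // (lt_trans y0).
Unshelve. all: by end_near. Qed.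

(** An explicit antiderivative. Two powers occur together because only their
    difference has a sign in [radial_integral]. *)
Lemma integral_power_tail (c1 c2 p q M : R) : 0 < p -> 0 < q -> 0 < M ->
  let f x := c1 * (p * x `^ (- p - 1)) - c2 * (q * x `^ (- q - 1)) in
  (forall x, M <= x -> 0 <= f x) ->
  (\int[leb]_(x in `[M, +oo[) (f x)%:E =
   (c1 * M `^ (- p) - c2 * M `^ (- q))%:E)%E.
Proof.
move=> p0 q0 M0 f f0.
pose F (x : R) := - c1 * x `^ (- p) + c2 * x `^ (- q).
have dF x : M <= x -> is_derive x (1 : R) F (f x).
  move=> Mx; have x0 : 0 < x by exact: lt_le_trans Mx.
  have d1 := is_derive1_powR (- p) x0; have d2 := is_derive1_powR (- q) x0.
  have [D E] := is_deriveD (is_deriveZ (- c1) d1) (is_deriveZ c2 d2).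
  by split; [exact: D|rewrite [LHS]E /f /GRing.scale /=; ring].
have cpow (s x : R) : 0 < x -> {for x, continuous (fun y : R => y `^ s)}.
  move=> x0; apply/differentiable_continuous/derivable1_diffP.
  by apply: derivable_powR; rewrite in_itv /= x0.
have cf x : 0 < x -> {for x, continuous f}.
  move=> x0; by apply: cvgB; apply: cvgMl_tmp; apply: cvgMl_tmp; exact: cpow.
rewrite (@ge0_continuous_FTC2y _ f F M 0) //.
- by rewrite sub0e -EFinN; congr EFin; rewrite /F; ring.
- apply/continuous_within_itvcyP; split=> [x|].
    by rewrite in_itv /= andbT => Mx; apply: cf; exact: lt_trans Mx.
  by apply: cvg_at_right_filter; exact: cf.
- rewrite -[0]addr0; apply: cvgD.
    by rewrite -[0](mulr0 (- c1)); apply: cvgMl_tmp; exact: powRN_cvg0.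
  by rewrite -[0](mulr0 c2); apply: cvgMl_tmp; exact: powRN_cvg0.
- by move=> x /ltW Mx; case: (dF x Mx).
- apply: cvg_at_right_filter.
  by apply/differentiable_continuous/derivable1_diffP; case: (dF M (lexx M)).
- move=> x; rewrite in_itv /= andbT => /ltW Mx.
  by rewrite derive1E; case: (dF x Mx).
Qed.

Context d0 (T : measurableType d0) (mu : {sigma_finite_measure set T -> \bar R}).
Context (D : T -> R) (mD : measurable_fun setT D) (Q : nat) (K : R) (K0 : 0 <= K).
Hypothesis ballE : forall r, 0 < r -> mu [set x | D x < r] = (r ^+ Q * K)%:E.

Let measurable_lt r : measurable [set x | D x < r].
Proof.
rewrite (_ : [set x | _] = setT `&` (D @^-1` `]-oo, r[)).
  by apply: mD => //; exact: measurable_itv.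
by rewrite setTI; apply/seteqP; split=> x; rewrite /= in_itv.
Qed.

Lemma measurable_radial_ge M : measurable [set x | M <= D x].
Proof.
rewrite (_ : [set x | _] = ~` [set x | D x < M]); first exact: measurableC.
by apply/seteqP; split=> x /=; rewrite leNgt => /negP.
Qed.

Lemma radial_shell M r : 0 < M -> M < r ->
  mu [set x | M <= D x < r] = ((r ^+ Q - M ^+ Q) * K)%:E.
Proof.
move=> M0 Mr; have r0 : 0 < r by exact: lt_trans Mr.
have mS : measurable [set x | M <= D x < r].
  rewrite (_ : [set x | _] = [set x | M <= D x] `&` [set x | D x < r]).
    by apply: measurableI => //; exact: measurable_radial_ge.
  by apply/seteqP; split=> x /= => [/andP[]|[-> ->]].
have : mu [set x | D x < r] =
      (mu [set x | D x < M]%R + mu [set x | M <= D x < r]%R)%E.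
  rewrite -measureU //; last first.
    by apply/seteqP; split=> x //= [xM /andP[]]; rewrite leNgt xM.
  congr (mu _); apply/seteqP; split=> x /=.
    by move=> ->; case: (ltP (D x) M) => _; [left|right].
  by move=> [/lt_trans->//|/andP[]].
rewrite !ballE //; case: (mu [set x | M <= _ < _]) => [v| |] //.
by rewrite -EFinD => -[] E; congr EFin; rewrite mulrBl; lra.
Qed.

(** Integrating the measure of shells: [D^-b] is the integral of [b r^(-b-1)]
    over [r > D], and Tonelli's theorem exchanges [r] and the point. *)
Lemma radial_integral a M : 0 < a -> 0 < M ->
  (\int[mu]_(x in [set x | M <= D x]%R) (D x `^ (- (Q%:R + a)))%:E =
   (Q%:R * K / a * M `^ (- a))%:E)%E.
Proof.
move=> a0 M0; pose b := Q%:R + a.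
have b0 : 0 < b by rewrite ltr_wpDl.
pose g (r : R) := b * r `^ (- b - 1).
have g0 r : 0 <= g r by rewrite mulr_ge0 ?powR_ge0 // ltW.
have mg : measurable_fun setT g by apply: measurable_funM.
pose S : set (T * measurableTypeR R) := [set p | M <= D p.1 < p.2].
have mS : measurable S.
  rewrite (_ : S = (fst @^-1` [set x | M <= D x]) `&`
      (setT `&` ((fun p : T * measurableTypeR R => D p.1 - p.2) @^-1` `]-oo, 0[))).
    apply: measurableI.
      rewrite -[X in measurable X]setTI.
      by apply: measurable_fst => //; exact: measurable_radial_ge.
    have mf : measurable_fun setT (fun p : T * measurableTypeR R => D p.1 - p.2).
      apply: measurable_funB; first exact: measurableT_comp mD measurable_fst.
      exact: measurable_snd.
    by apply: mf => //; exact: measurable_itv.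
  apply/seteqP; split=> p; rewrite /S /= in_itv /= subr_lt0.
    by move=> /andP[].
  by move=> [-> [_ ->]].
pose f (p : T * measurableTypeR R) : \bar R := (g p.2 * \1_S p)%:E.
have mf : measurable_fun setT f.
  apply/measurable_EFinP/measurable_funM; last exact: measurable_indic.
  exact: measurableT_comp mg measurable_snd.
have f0 p : (0 <= f p)%E by rewrite lee_fin mulr_ge0.
transitivity (\int[mu]_x \int[leb]_r f (x, r))%E.
  rewrite integral_mkcond; apply: eq_integral => x _; rewrite patchE.
  case: (leP M (D x)) => Mx.
    rewrite mem_set //; have -> : (\int[leb]_r f (x, r) = \int[leb]_(r in `]D x, +oo[) (g r)%:E)%E.
      rewrite [RHS]integral_mkcond; apply: eq_integral => r _; rewrite patchE /f /S indicE.
      rewrite (_ : (_ \in _) = (r \in (`]D x, +oo[%classic : set R))).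
        by case: (r \in _); rewrite ?mulr1 ?mulr0.
      by apply/idP/idP; rewrite !inE /= in_itv /= andbT Mx.
    rewrite integral_itv_obnd_cbnd; last exact/measurable_EFinP/measurable_funTS.
    have Dx0 : 0 < D x by exact: lt_le_trans Mx.
    have := @integral_power_tail 1 0 b b (D x) b0 b0 Dx0.
    rewrite mul1r mul0r subr0 => <-; last first.
      by move=> r _; rewrite mul1r mul0r subr0; exact: g0.
    by apply: eq_integral => r _; rewrite mul1r mul0r subr0.
  rewrite memNset /=; last by apply/negP; rewrite -ltNge.
  by rewrite integral0_eq // => r _; rewrite /f /S indicE memNset ?mulr0 //= leNgt Mx.
rewrite fubini_tonelli //.
have shellE r : (\int[mu]_x f (x, r) = (g r)%:E * mu [set x | M <= D x < r]%R)%E.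
  have mSr : measurable [set x | M <= D x < r].
    rewrite (_ : [set x | _] = [set x | M <= D x] `&` [set x | D x < r]).
      by apply: measurableI => //; exact: measurable_radial_ge.
    by apply/seteqP; split=> x /= => [/andP[]|[-> ->]].
  transitivity (\int[mu]_x ((g r)%:E * (\1_[set x | M <= D x < r]%R x)%:E))%E.
    by apply: eq_integral => x _; rewrite /f -EFinM; congr (_ * _)%:E.
  pose I : T -> R := \1_[set x | M <= D x < r].
  have mI : measurable_fun setT (EFin \o I).
    by apply/measurable_EFinP; exact: measurable_indic.
  have I0 x : setT x -> (0 <= (EFin \o I) x)%E by rewrite lee_fin.
  have gr0 : (0 <= (g r)%:E)%E by rewrite lee_fin.
  have := ge0_integralZl mu measurableT mI I0 gr0 => /= ->.
  by rewrite /= integral_indic // setIT.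
transitivity (\int[leb]_(r in `]M, +oo[) (K * (g r * (r ^+ Q - M ^+ Q)))%:E)%E.
  rewrite [RHS]integral_mkcond; apply: eq_integral => r _; rewrite shellE patchE.
  case: (ltP M r) => Mr.
    rewrite mem_set /= ?in_itv /= ?Mr //.
    by rewrite radial_shell // -EFinM; congr EFin; ring.
  rewrite memNset /= ?in_itv /= ?andbT; last by apply/negP; rewrite -leNgt.
  rewrite (_ : [set x | _] = set0) ?measure0 ?mule0 //.
  apply/seteqP; split=> x //= /andP[H1 H2].
  by move: (le_lt_trans H1 H2); rewrite ltNge Mr.
rewrite integral_itv_obnd_cbnd; last first.
  apply/measurable_EFinP/measurable_funTS/measurable_funM => //.
  apply: measurable_funM => //; apply: continuous_measurable_fun => x.
  by apply: cvgB; [exact: exprn_continuous|exact: cvg_cst].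
have split_power r : 0 < r -> K * (g r * (r ^+ Q - M ^+ Q)) =
    K * b / a * (a * r `^ (- a - 1)) - K * M ^+ Q * (b * r `^ (- b - 1)).
  move=> r0; have -> : r `^ (- a - 1) = r `^ (- b - 1) * r ^+ Q.
    rewrite -powR_mulrn ?(ltW r0) // -powRD; first by congr (_ `^ _); rewrite /b; ring.
    by rewrite (gt_eqF r0) implybT.
  by rewrite /g; field; rewrite gt_eqF.
have := @integral_power_tail (K * b / a) (K * M ^+ Q) a b M a0 b0 M0.
have -> : K * b / a * M `^ (- a) - K * M ^+ Q * M `^ (- b) = Q%:R * K / a * M `^ (- a).
  have -> : M `^ (- a) = M ^+ Q * M `^ (- b).
    rewrite -powR_mulrn ?(ltW M0) // -powRD; first by congr (_ `^ _); rewrite /b; ring.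
    by rewrite (gt_eqF M0) implybT.
  by rewrite /b; field; rewrite gt_eqF.
move=> <-.
  apply: eq_integral => r; rewrite inE /= in_itv /= andbT => Mr; congr EFin.
  by rewrite split_power // (lt_le_trans M0).
move=> r Mr; rewrite -split_power; last exact: lt_le_trans Mr.
by rewrite mulr_ge0 // mulr_ge0 // subr_ge0 lerXn2r // nnegrE ltW // (lt_le_trans M0).
Qed.

End radial_integral.

(** * Limits inferior and superior *)

Section limits_inferior_and_superior.
Context {T : choiceType} {X : filteredType T} {R : realType}.
Variables (F : set_system X) (PF : ProperFilter F).
Implicit Types (f : X -> \bar R).
Local Open Scope ereal_scope.

Lemma limf_esup_le f b : (\forall x \near F, f x <= b) -> limf_esup f F <= b.
Proof.
move=> fb; rewrite limf_esupE; apply: ge_ereal_inf.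
exists (ereal_sup (f @` [set x | f x <= b])); first by exists [set x | f x <= b].
by apply/ge_ereal_sup => _ [x /= xb <-].
Qed.

Lemma limf_einf_ge f b : (\forall x \near F, b <= f x) -> b <= limf_einf f F.
Proof.
move=> fb; rewrite limf_einfE; apply: le_ereal_sup_tmp.
exists (ereal_inf (f @` [set x | b <= f x])); first by exists [set x | b <= f x].
by apply: le_ereal_inf_tmp => _ [x /= xb <-].
Qed.

Lemma limf_einf_le_esup f : limf_einf f F <= limf_esup f F.
Proof.
rewrite limf_einfE limf_esupE; apply/ge_ereal_sup => _ [A FA <-].
apply: le_ereal_inf_tmp => _ [B FB <-].
have [x [Ax Bx]] := filter_ex (filterI FA FB).
apply: (@le_trans _ _ (f x)).
  by apply: ge_ereal_inf; exists (f x) => //; exists x.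
by apply: le_ereal_sup_tmp; exists (f x) => //; exists x.
Qed.

Lemma limf_einf_le_cvg f l : f x @[x --> F] --> l -> limf_einf f F <= l.
Proof.
move=> fl; rewrite limf_einfE; apply/ge_ereal_sup => _ [A FA <-].
apply: (closed_cvg (u_ := f) (fun y => ereal_inf (f @` A) <= y) _ _ l fl).
  exact: closed_ereal_le_ereal.
apply: filterS FA => x Ax /=.
by apply: ge_ereal_inf; exists (f x) => //; exists x.
Qed.

Lemma cvg_le_limf_esup f l : f x @[x --> F] --> l -> l <= limf_esup f F.
Proof.
move=> fl; rewrite limf_esupE; apply: le_ereal_inf_tmp => _ [A FA <-].
apply: (closed_cvg (u_ := f) (fun y => y <= ereal_sup (f @` A)) _ _ l fl).
  exact: closed_ereal_ge_ereal.
apply: filterS FA => x Ax /=.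
by apply: le_ereal_sup_tmp; exists (f x) => //; exists x.
Qed.

End limits_inferior_and_superior.

(** * Fractional modulars on metric measure spaces *)

Section integrals_of_nonnegative_functions.
Context {R : realType} d (X : measurableType d) (m : {measure set X -> \bar R}).
Implicit Types f g : X -> R.

Lemma le_integral_EFin f g : measurable_fun setT f -> measurable_fun setT g ->
  (forall x, 0 <= f x) -> (forall x, f x <= g x) ->
  (\int[m]_x (f x)%:E <= \int[m]_x (g x)%:E)%E.
Proof.
move=> mf mg f0 fg; apply: ge0_le_integral => //.
- by move=> x _; rewrite lee_fin.
- exact/measurable_EFinP.
- exact/measurable_EFinP.
- by move=> x _; rewrite lee_fin.
Qed.

Lemma integralD_EFin f g : measurable_fun setT f -> measurable_fun setT g ->
  (forall x, 0 <= f x) -> (forall x, 0 <= g x) ->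
  (\int[m]_x (f x + g x)%:E = \int[m]_x (f x)%:E + \int[m]_x (g x)%:E)%E.
Proof.
move=> mf mg f0 g0; rewrite -ge0_integralD //.
- by move=> x _; rewrite lee_fin.
- exact/measurable_EFinP.
- by move=> x _; rewrite lee_fin.
- exact/measurable_EFinP.
Qed.

Lemma integralZ_EFin (c : R) f : 0 <= c -> measurable_fun setT f ->
  (forall x, 0 <= f x) ->
  (\int[m]_x (c * f x)%:E = c%:E * \int[m]_x (f x)%:E)%E.
Proof.
move=> c0 mf f0; rewrite -ge0_integralZl //.
- exact/measurable_EFinP.
- by move=> x _; rewrite lee_fin.
Qed.

End integrals_of_nonnegative_functions.

Lemma eq_le_trans d (X : porderType d) (x y z : X) :
  x = y -> (y <= z -> x <= z)%O.
Proof. by move=> ->. Qed.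

(** [D] is a distance and [N] the distance to a base point; balls have the measure
    [K * r ^+ Q] of a homogeneous space. *)
Section metric_measure_estimates.
Context {R : realType} (phi : R -> R) (pm pp : R) (hphi : is_orlicz phi pm pp).
Context d0 (T : measurableType d0) (mu : {sigma_finite_measure set T -> \bar R}).
Context (N : T -> R) (D : T * T -> R) (Q : nat) (K C : R).
Context (mN : measurable_fun setT N) (mD : measurable_fun setT D).
Hypothesis N0 : forall x, 0 <= N x.
Hypothesis D0 : forall p, 0 <= D p.
Hypothesis Dsym : forall x y, D (x, y) = D (y, x).
Hypothesis Dtri : forall x y, D (x, y) <= N x + N y.
Hypothesis Dtri' : forall x y, N x - N y <= D (x, y).
Hypothesis K0 : 0 <= K.
Hypothesis ballN : forall r, 0 < r -> mu [set x | N x < r] = (r ^+ Q * K)%:E.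
Hypothesis ballD : forall y r, 0 < r -> mu [set x | D (x, y) < r] = (r ^+ Q * K)%:E.
Hypothesis C0 : 0 < C.
Hypothesis doublingC : forall t, 0 <= t -> orlicz_fun phi (2 * t) <= C * orlicz_fun phi t.
Context (v : T -> R) (mv : measurable_fun setT v).
Local Notation Phi := (orlicz_fun phi).
Local Notation P := (\int[mu]_x (Phi `|v x|)%:E)%E.

Lemma product_integral_swap (f : T * T -> \bar R) :
  measurable_fun setT f -> (forall p, 0 <= f p)%E ->
  (\int[mu \x mu]_p f (p.2, p.1) = \int[mu \x mu]_p f p)%E.
Proof.
move=> mf f0; rewrite fubini_tonelli1; first last.
- by move=> p; exact: f0.
- by apply: (measurableT_comp mf); exact: measurable_swap.
by rewrite fubini_tonelli2.
Qed.

Lemma measurable_Phi_v : measurable_fun setT (fun x => Phi `|v x|).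
Proof.
apply: (measurableT_comp (measurable_orlicz_fun hphi)).
exact: measurableT_comp.
Qed.

(** The integrand of [frac_modular], for an abstract distance and dimension. *)
Definition quotient_integrand s (p : T * T) : R :=
  Phi (`|v p.1 - v p.2| / D p `^ s) / D p ^+ Q.
Local Notation h := quotient_integrand.

Lemma quotient_integrand_ge0 s p : 0 <= h s p.
Proof. by rewrite divr_ge0 ?exprn_ge0 // (orlicz_fun_ge0 hphi). Qed.

Lemma measurable_powR_comp d1 (T1 : measurableType d1) (f : T1 -> R) s :
  measurable_fun setT f -> measurable_fun setT (fun p => f p `^ s).
Proof. exact: (measurableT_comp (measurable_powR s)). Qed.

Lemma measurable_quotient_integrand s : measurable_fun setT (h s).
Proof.
rewrite (_ : h s = fun p => Phi (`|v p.1 - v p.2| * D p `^ (- s)) * D p `^ (- Q%:R)).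
  apply: measurable_funM.
    apply: (measurableT_comp (measurable_orlicz_fun hphi)).
    apply: measurable_funM.
      apply: measurableT_comp => //; apply: measurable_funB.
        exact: measurableT_comp mv measurable_fst.
      exact: measurableT_comp mv measurable_snd.
    exact: measurable_powR_comp.
  exact: measurable_powR_comp.
by apply/funext => p; rewrite /h powRN powR_invn.
Qed.

Lemma quotient_integrand_sym s p : h s (p.2, p.1) = h s p.
Proof. by case: p => x y; rewrite /h /= distrC Dsym. Qed.

Lemma measurable_ge_dist (M : T -> R) : measurable_fun setT M ->
  measurable [set p : T * T | M p.2 <= D p].
Proof.
move=> mM; rewrite (_ : [set p | _] =
    setT `&` ((fun p : T * T => D p - M p.2) @^-1` `[0, +oo[)).
  have mf : measurable_fun setT (fun p : T * T => D p - M p.2).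
    apply: measurable_funB => //; exact: measurableT_comp mM measurable_snd.
  by apply: mf => //; exact: measurable_itv.
by rewrite setTI; apply/seteqP; split=> p; rewrite /= in_itv /= andbT subr_ge0.
Qed.

(** The weight that [radial_integral] integrates in its first variable. *)
Definition tail_weight (M : T -> R) a (p : T * T) : R :=
  \1_[set p : T * T | M p.2 <= D p] p * D p `^ (- (Q%:R + a)).

Lemma tail_weight_ge0 M a p : 0 <= tail_weight M a p.
Proof. by rewrite mulr_ge0 ?powR_ge0. Qed.

Lemma measurable_tail_weight M a : measurable_fun setT M ->
  measurable_fun setT (tail_weight M a).
Proof.
move=> mM; apply: measurable_funM.
  by apply: measurable_indic; exact: measurable_ge_dist.
exact: measurable_powR_comp.
Qed.

Lemma integral_tail_weight (M g : T -> R) a : 0 < a ->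
  measurable_fun setT M -> (forall x, 0 < M x) ->
  measurable_fun setT g -> (forall x, 0 <= g x) ->
  (\int[mu \x mu]_p (tail_weight M a p * g p.2)%:E =
   (Q%:R * K / a)%:E * \int[mu]_y (g y * M y `^ (- a))%:E)%E.
Proof.
move=> a0 mM M0 mg g0.
rewrite fubini_tonelli2; first last.
- by move=> p; rewrite lee_fin mulr_ge0 ?tail_weight_ge0.
- apply/measurable_EFinP/measurable_funM; first exact: measurable_tail_weight.
  exact: measurableT_comp mg measurable_snd.
pose gM y : R := g y * M y `^ (- a).
have mgM : measurable_fun setT (EFin \o gM).
  by apply/measurable_EFinP/measurable_funM => //; exact: measurable_powR_comp.
have gM0 y : setT y -> (0 <= (EFin \o gM) y)%E.
  by rewrite lee_fin mulr_ge0 ?powR_ge0.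
have QK0 : (0 <= (Q%:R * K / a)%:E)%E by rewrite lee_fin !mulr_ge0 // invr_ge0 ltW.
rewrite -(ge0_integralZl mu measurableT mgM gM0 QK0).
apply: eq_integral => y _; rewrite /fubini_G /=.
have mDy : measurable_fun setT (fun x => D (x, y)).
  exact: (measurableT_comp mD (pair2_measurable y)).
have mS : measurable [set x | M y <= D (x, y)] by exact: measurable_radial_ge.
transitivity ((g y)%:E * \int[mu]_(x in [set x | M y <= D (x, y)]%R)
   (D (x, y) `^ (- (Q%:R + a)))%:E)%E.
  have mf : measurable_fun [set x | M y <= D (x, y)]
      (EFin \o (fun x => D (x, y) `^ (- (Q%:R + a)))).
    by apply/measurable_EFinP/measurable_funTS; exact: measurable_powR_comp.
  rewrite -(ge0_integralZl mu mS mf) ?lee_fin //; last first.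
    by move=> x _; rewrite lee_fin powR_ge0.
  rewrite [RHS]integral_mkcond; apply: eq_integral => x _; rewrite patchE /tail_weight indicE.
  case: (leP (M y) (D (x, y))) => MD.
    by rewrite !mem_set //= mul1r mulrC EFinM.
  by rewrite !memNset /= ?leNgt ?MD // mul0r mul0r.
rewrite (radial_integral mDy K0 (ballD y) a0 (M0 y)) -!EFinM; congr EFin; rewrite /gM; ring.
Qed.

Local Notation F s := (\int[mu \x mu]_p (h s p)%:E)%E.

Let hE0 s p : (0 <= (h s p)%:E)%E.
Proof. by rewrite lee_fin quotient_integrand_ge0. Qed.

Let m1 : measurable_fun setT (cst 1 : T -> R).
Proof. exact: measurable_cst. Qed.

(** Near the diagonal the quotient increases with [s]; away from it convexity and
    doubling separate [v p.1] from [v p.2]. *)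
Lemma quotient_integrand_upper s s0 p : 0 < s -> s <= s0 ->
  h s p <= h s0 p +
    (C / 2 * (tail_weight (cst 1) (s * pm) p * Phi `|v p.1|) +
     C / 2 * (tail_weight (cst 1) (s * pm) p * Phi `|v p.2|)).
Proof.
move=> s_gt0 ss0; have Phi_ge0 := orlicz_fun_ge0 hphi.
have C20 : 0 <= C / 2 by rewrite divr_ge0 // ltW.
have tail_ge0 x : 0 <= C / 2 * (tail_weight (cst 1) (s * pm) p * Phi `|v x|).
  by rewrite mulr_ge0 // mulr_ge0 // tail_weight_ge0.
have [Dp|Dp] := ltP (D p) 1.
  apply: (@le_trans _ _ (h s0 p)); last by rewrite lerDl addr_ge0.
  apply: ler_wpM2r; first by rewrite invr_ge0 exprn_ge0.
  apply: (orlicz_fun_nd hphi).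
  have := D0 p; rewrite le_eqVlt => /predU1P[<-|Dp0].
    by rewrite !powR0 ?gt_eqF // (lt_le_trans s_gt0).
  rewrite ler_wpM2l // lef_pV2 ?posrE ?powR_gt0 //.
  by apply: ger_powR; rewrite // Dp0 ltW.
rewrite -[leLHS]add0r lerD ?quotient_integrand_ge0 //.
have Dp0 : 0 < D p by exact: lt_le_trans Dp.
have Ds0 : 0 < D p `^ s by exact: powR_gt0.
have -> : tail_weight (cst 1) (s * pm) p = D p `^ (- (s * pm)) / D p ^+ Q.
  rewrite /tail_weight indicE mem_set //= mul1r opprD powRD ?powR_invn //.
    by rewrite mulrC.
  by rewrite (gt_eqF Dp0) implybT.
set a := `|v p.1|; set b := `|v p.2|; set w := _ `^ (- _).
have a0 : 0 <= a / D p `^ s by exact: divr_ge0 (normr_ge0 _) (ltW Ds0).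
have b0 : 0 <= b / D p `^ s by exact: divr_ge0 (normr_ge0 _) (ltW Ds0).
have half c : 0 <= c -> 0 <= c / D p `^ s -> Phi (2 * (c / D p `^ s)) <= C * (w * Phi c).
  move=> c0 cD0; apply: (le_trans (doublingC cD0)); rewrite ler_wpM2l ?(ltW C0) //.
  exact: (orlicz_fun_upper_power hphi Dp (ltW s_gt0) c0).
have core : Phi (`|v p.1 - v p.2| / D p `^ s) <= C / 2 * (w * Phi a + w * Phi b).
  apply: (@le_trans _ _ (Phi (a / D p `^ s + b / D p `^ s))).
    apply: (orlicz_fun_nd hphi); rewrite -mulrDl ler_wpM2r ?invr_ge0 ?(ltW Ds0) //.
    exact: ler_normB.
  apply: (le_trans (orlicz_fun_midpoint hphi a0 b0)).
  have := half _ (normr_ge0 (v p.1)) a0; have := half _ (normr_ge0 (v p.2)) b0.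
  rewrite -/a -/b; move: (Phi (2 * _)) (Phi (2 * _)) => X Y.
  by move: (w * Phi a) (w * Phi b) => A B H1 H2; lra.
have q0 : 0 <= (D p ^+ Q)^-1 by rewrite invr_ge0 exprn_ge0.
apply: (le_trans (ler_wpM2r q0 core)).
by rewrite le_eqVlt; apply/orP; left; apply/eqP; ring.
Qed.

Lemma Phi_modular_ge0 : (0 <= P)%E.
Proof. by apply: integral_ge0 => x _; rewrite lee_fin (orlicz_fun_ge0 hphi). Qed.

Lemma integral_tail_Phi s : 0 < s ->
  (\int[mu \x mu]_p (tail_weight (cst 1) (s * pm) p * Phi `|v p.2|)%:E =
   (Q%:R * K / (s * pm))%:E * P)%E.
Proof.
move=> s0; have [pm0 _] := orlicz_exponents_gt0 hphi.
rewrite (integral_tail_weight (mulr_gt0 s0 pm0) m1 _ measurable_Phi_v) //; last first.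
  by move=> x; exact: orlicz_fun_ge0 hphi _.
by congr (_ * _)%E; apply: eq_integral => x _; rewrite powR1 mulr1.
Qed.

Lemma tail_weight_sym c a p :
  tail_weight (cst c) a (p.2, p.1) = tail_weight (cst c) a p.
Proof.
case: p => x y; rewrite /tail_weight /= [D (y, x)]Dsym !indicE.
suff -> : ((y, x) \in [set p : T * T | c <= D p]) = ((x, y) \in [set p | c <= D p]) by [].
by apply/idP/idP => /set_mem /= H; apply/mem_set; rewrite /= Dsym.
Qed.

Hypothesis P_fin : (P < +oo)%E.

Let P_EFin : exists2 q, 0 <= q & P = q%:E.
Proof.
exists (fine P); first exact/fine_ge0/Phi_modular_ge0.
by rewrite fineK // ge0_fin_numE // Phi_modular_ge0.
Qed.

(** The two symmetric tails of [quotient_integrand_upper] contribute equally, and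
    each is [C / 2 * (Q * K / (s * pm))] times the modular. *)
Lemma fractional_modular_upper s s0 : 0 < s -> s <= s0 ->
  (s%:E * F s <= s%:E * F s0 + C%:E * (Q%:R%:E * K%:E * pm^-1%:E) * P)%E.
Proof.
move=> s_gt0 ss0; have [pm0 _] := orlicz_exponents_gt0 hphi.
have [q q0 PE] := P_EFin; pose c := Q%:R * K / (s * pm).
have c0 : 0 <= c := divr_ge0 (mulr_ge0 (ler0n R Q) K0) (ltW (mulr_gt0 s_gt0 pm0)).
have C20 : 0 <= C / 2 := divr_ge0 (ltW C0) (ler0n R 2).
have C20E : (0 <= (C / 2)%:E)%E by rewrite lee_fin.
have tail0 : (0 <= (C * (c * q))%:E)%E.
  by rewrite lee_fin; exact: mulr_ge0 (ltW C0) (mulr_ge0 c0 q0).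
have sE : (0 <= s%:E)%E by rewrite lee_fin ltW.
have Fs0 : (0 <= F s0)%E by apply: integral_ge0 => p _; exact: hE0.
pose w := tail_weight (cst 1) (s * pm).
pose g (p : T * T) := w p * Phi `|v p.2|.
pose g' (p : T * T) := w p * Phi `|v p.1|.
have mw : measurable_fun setT w by exact: measurable_tail_weight.
have mg : measurable_fun setT g.
  apply: measurable_funM => //.
  exact: measurableT_comp measurable_Phi_v measurable_snd.
have mg' : measurable_fun setT g'.
  apply: measurable_funM => //.
  exact: measurableT_comp measurable_Phi_v measurable_fst.
have g0 p : 0 <= g p by rewrite mulr_ge0 ?tail_weight_ge0 // (orlicz_fun_ge0 hphi).
have g'0 p : 0 <= g' p by rewrite mulr_ge0 ?tail_weight_ge0 // (orlicz_fun_ge0 hphi).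
have gg' : (\int[mu \x mu]_p (g' p)%:E = \int[mu \x mu]_p (g p)%:E)%E.
  rewrite -[RHS]product_integral_swap; first last.
  - by move=> p; rewrite lee_fin.
  - exact/measurable_EFinP.
  by apply: eq_integral => p _; rewrite /g /g' /w tail_weight_sym.
have E : (F s <= F s0 + ((C / 2)%:E * \int[mu \x mu]_p (g p)%:E +
                        (C / 2)%:E * \int[mu \x mu]_p (g p)%:E))%E.
  have mcg : measurable_fun setT (fun p => C / 2 * g p) by exact: measurable_funM.
  have mcg' : measurable_fun setT (fun p => C / 2 * g' p) by exact: measurable_funM.
  have cg0 p : 0 <= C / 2 * g p by rewrite mulr_ge0.
  have cg'0 p : 0 <= C / 2 * g' p by rewrite mulr_ge0.
  pose S p := C / 2 * g' p + C / 2 * g p.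
  have mS : measurable_fun setT S by exact: measurable_funD.
  have S0 p : 0 <= S p by exact: addr_ge0.
  have mh t := measurable_quotient_integrand t.
  have h0 t := quotient_integrand_ge0 t.
  apply: le_trans (le_integral_EFin _ (mh s) (measurable_funD (mh s0) mS) (h0 s)
    (fun p => quotient_integrand_upper p s_gt0 ss0)) _.
  apply: eq_le_trans (integralD_EFin _ (mh s0) mS (h0 s0) S0) _; apply: leeD2l.
  apply: eq_le_trans (integralD_EFin _ mcg' mcg cg'0 cg0) _; apply: leeD.
    apply: eq_le_trans (integralZ_EFin _ C20 mg' g'0) _.
    exact: (lee_wpmul2l C20E (eq_le_trans gg' (lexx _))).
  exact: eq_le_trans (integralZ_EFin _ C20 mg g0) (lexx _).
have gE : (\int[mu \x mu]_p (g p)%:E = (c * q)%:E)%E.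
  by apply: etrans (integral_tail_Phi s_gt0) _; rewrite PE -EFinM.
have tailE : ((C / 2)%:E * \int[mu \x mu]_p (g p)%:E +
              (C / 2)%:E * \int[mu \x mu]_p (g p)%:E = (C * (c * q))%:E)%E.
  by rewrite gE -!EFinM -EFinD; congr EFin; field.
rewrite tailE in E; rewrite PE; apply: (le_trans (lee_wpmul2l sE E)).
rewrite (ge0_muleDr _ Fs0 tail0); apply: leeD2l.
rewrite -!EFinM lee_fin le_eqVlt; apply/orP; left.
by apply/eqP; rewrite /c; field; rewrite !gt_eqF.
Qed.

(** At a distance of more than [3 * N p.2] from [p.2], the point [p.1] is more than
    twice as far out as [p.2], which separates the region from its mirror image;
    the summand [2] makes powers of the distance monotone in the exponent. *)
Definition far_radius x : R := 3 * N x + 2.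
Definition far_weight (p : T * T) : R :=
  \1_[set p : T * T | far_radius p.2 <= D p] p.

Lemma far_radius_gt0 x : 0 < far_radius x.
Proof. by rewrite /far_radius; have := N0 x; lra. Qed.

Lemma measurable_far_radius : measurable_fun setT far_radius.
Proof. by apply: measurable_funD => //; exact: measurable_funM. Qed.

Lemma far_region p : far_radius p.2 <= D p ->
  [/\ 2 * N p.2 < N p.1, 2 <= N p.1 & N p.1 / 2 <= D p].
Proof.
case: p => x y /=; rewrite /far_radius => H.
have := Dtri x y; have := Dtri' x y; have := N0 x; have := N0 y.
by move=> *; split; lra.
Qed.

(** A bound for [D p ^- Q] on the far region which depends on [p.1] alone. Its
    support in [p.2] is a ball of measure [K * (N p.1 / 2) ^+ Q], so that its
    integral over [p.2] is at most [K], whatever [s] is. *)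
Definition error_weight (p : T * T) : R :=
  \1_[set p : T * T | 2 <= N p.1 /\ N p.2 < N p.1 / 2] p * (N p.1 / 2) ^- Q.

(** Convexity and doubling for [|v p.2| <= |v p.1 - v p.2| + |v p.1|], all divided
    by [D p `^ s]. The term in [v p.1] does not decay, but [D p] is at least
    [N p.1 / 2] there. *)
Lemma quotient_integrand_lower s p : 0 < s ->
  2 / C * (tail_weight far_radius (s * pp) p * Phi `|v p.2|) <=
  far_weight p * h s p + error_weight p * Phi `|v p.1|.
Proof.
move=> s0; have Phi_ge0 := orlicz_fun_ge0 hphi.
rewrite /tail_weight /far_weight indicE; case: (boolP (_ \in _)) => [/set_mem/= H|_]; last first.
  by rewrite !mul0r mulr0 add0r !mulr_ge0 // invr_ge0 exprn_ge0 // divr_ge0.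
have [H1 H2 H3] := far_region H.
have D1 : 1 <= D p by apply: le_trans H3; lra.
have Dp0 : 0 < D p by exact: lt_le_trans D1.
rewrite !mul1r /error_weight indicE mem_set /= ?mul1r; last by split=> //; lra.
rewrite opprD powRD ?powR_invn //; last by rewrite (gt_eqF Dp0) implybT.
have Ds1 : 1 <= D p `^ s by rewrite -(powRr0 (D p)) ler_powR // ltW.
have Ds0 : 0 < D p `^ s by exact: lt_le_trans Ds1.
set a := `|v p.1|; set b := `|v p.2|.
pose q := (D p ^+ Q)^-1.
have q0 : 0 <= q by rewrite invr_ge0 exprn_ge0.
pose A := Phi (`|v p.1 - v p.2| / D p `^ s).
have E1 : D p `^ (- (s * pp)) * Phi b <= Phi (b / D p `^ s).
  exact: (orlicz_fun_lower_power hphi D1 (ltW s0) (normr_ge0 _)).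
have E2 : 2 / C * Phi (b / D p `^ s) <= A + Phi (a / D p `^ s).
  have a0 : 0 <= a / D p `^ s by exact: divr_ge0 (normr_ge0 _) (ltW Ds0).
  have c0 : 0 <= `|v p.1 - v p.2| / D p `^ s by exact: divr_ge0 (normr_ge0 _) (ltW Ds0).
  have tri : b / D p `^ s <= `|v p.1 - v p.2| / D p `^ s + a / D p `^ s.
    rewrite -mulrDl ler_wpM2r ?invr_ge0 ?(ltW Ds0) // addrC -lerBlDl.
    by rewrite distrC; exact: lerB_dist.
  have M := le_trans (orlicz_fun_nd hphi tri) (orlicz_fun_midpoint hphi c0 a0).
  have HA : Phi (2 * (`|v p.1 - v p.2| / D p `^ s)) <= C * A := doublingC c0.
  have Ha := doublingC a0.
  have {}M : 2 * Phi (b / D p `^ s) <= (A + Phi (a / D p `^ s)) * C by lra.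
  by rewrite mulrAC ler_pdivrMr; [exact: M|exact: C0].
have E3 : Phi (a / D p `^ s) <= Phi a.
  by apply: (orlicz_fun_nd hphi); rewrite ler_pdivrMr // ler_peMr // normr_ge0.
have E4 : q <= (N p.1 / 2) ^- Q.
  rewrite lef_pV2 ?posrE ?exprn_gt0 //; last by lra.
  by apply: lerXn2r; rewrite ?nnegrE //; lra.
rewrite /h -/A -/q.
apply: (@le_trans _ _ ((A + Phi a) * q)).
  have E5 : 2 / C * (D p `^ (- (s * pp)) * Phi b) <= A + Phi a.
    apply: le_trans (lerD (lexx A) E3); apply: le_trans E2.
    by rewrite ler_wpM2l // divr_ge0 // ltW.
  apply: le_trans (ler_wpM2r q0 E5).
  by rewrite le_eqVlt; apply/orP; left; apply/eqP; ring.
rewrite mulrDl lerD2l mulrC; exact: ler_wpM2r.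
Qed.

Lemma measurable_far_weight : measurable_fun setT far_weight.
Proof. by apply: measurable_indic; apply: measurable_ge_dist; exact: measurable_far_radius. Qed.

Lemma far_weight_ge0 p : 0 <= far_weight p.
Proof. by []. Qed.

Lemma error_weight_ge0 p : 0 <= error_weight p.
Proof. by rewrite mulr_ge0 // invr_ge0 exprn_ge0 // divr_ge0. Qed.

Lemma measurable_error_weight : measurable_fun setT error_weight.
Proof.
have mN1 : measurable_fun setT (fun p : T * T => N p.1).
  exact: measurableT_comp mN measurable_fst.
have mN2 : measurable_fun setT (fun p : T * T => N p.2).
  exact: measurableT_comp mN measurable_snd.
apply: measurable_funM; last first.
  rewrite (_ : (fun _ => _) = fun p => (N p.1 / 2) `^ (- Q%:R)).
    by apply: measurable_powR_comp; exact: measurable_funM.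
  by apply/funext => p; rewrite powR_invn // divr_ge0.
apply: measurable_indic.
have m2N : measurable_fun setT (fun p : T * T => N p.1 / 2).
  exact: measurable_funM.
rewrite (_ : [set p : T * T | _] =
   ((fun p : T * T => N p.1) @^-1` `[2, +oo[) `&`
   ((fun p : T * T => N p.1 / 2 - N p.2) @^-1` `]0, +oo[)).
  apply: measurableI; rewrite -[X in measurable X]setTI.
    by apply: mN1 => //; exact: measurable_itv.
  by apply: measurable_funB => //; exact: measurable_itv.
by apply/seteqP; split=> p /=; rewrite !in_itv /= !andbT subr_gt0.
Qed.

Lemma integral_error_weight :
  (\int[mu \x mu]_p (error_weight p * Phi `|v p.1|)%:E <= K%:E * P)%E.
Proof.
have Phi_ge0 := orlicz_fun_ge0 hphi.
rewrite fubini_tonelli1; first last.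
- by move=> p; rewrite lee_fin mulr_ge0 ?error_weight_ge0.
- apply/measurable_EFinP/measurable_funM; first exact: measurable_error_weight.
  exact: measurableT_comp measurable_Phi_v measurable_fst.
have mP : measurable_fun setT (EFin \o (fun x => Phi `|v x|)).
  by apply/measurable_EFinP; exact: measurable_Phi_v.
have P0 x : setT x -> (0 <= (EFin \o (fun x => Phi `|v x|)) x)%E by rewrite lee_fin.
rewrite -(ge0_integralZl mu measurableT mP P0) ?lee_fin //.
apply: ge0_le_integral => //.
- by move=> x _; apply: integral_ge0 => y _; rewrite lee_fin mulr_ge0 ?error_weight_ge0.
- apply: measurable_fun_fubini_tonelli_F => /=.
  + apply/measurable_EFinP/measurable_funM; first exact: measurable_error_weight.
    exact: measurableT_comp measurable_Phi_v measurable_fst.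
  + by move=> p; rewrite lee_fin mulr_ge0 ?error_weight_ge0.
- by apply/measurable_EFinP/measurable_funM => //; exact: measurable_Phi_v.
move=> x _; rewrite /fubini_F /=.
have [N2|N2] := leP 2 (N x); last first.
  rewrite integral0_eq ?lee_fin ?mulr_ge0 // => y _.
  by rewrite /error_weight indicE memNset ?mul0r //= => -[]; rewrite leNgt N2.
have r0 : 0 < N x / 2 by lra.
have mS : measurable [set y | N y < N x / 2].
  rewrite (_ : [set y | _] = setT `&` N @^-1` `]-oo, N x / 2[).
    by apply: mN => //; exact: measurable_itv.
  by rewrite setTI; apply/seteqP; split=> y; rewrite /= in_itv.
pose c := (N x / 2) ^- Q * Phi `|v x|.
have c0 : 0 <= c by rewrite mulr_ge0 // invr_ge0 exprn_ge0 // ltW.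
rewrite (eq_integral (fun y => (c%:E * (\1_[set y | N y < N x / 2] y)%:E)%E)); last first.
  move=> y _; rewrite -EFinM /error_weight !indicE /= /c.
  suff -> : ((x, y) \in [set p : T * T | 2 <= N p.1 /\ N p.2 < N p.1 / 2]) =
      (y \in [set y | N y < N x / 2]) by congr EFin; ring.
  by apply/idP/idP => /set_mem /= H; apply/mem_set => //=; case: H.
have mI : measurable_fun setT (fun y => (\1_[set y | N y < N x / 2] y)%:E : \bar R).
  by apply/measurable_EFinP; exact: measurable_indic.
have I0 y : setT y -> (0 <= (\1_[set y | N y < N x / 2] y)%:E :> \bar R)%E.
  by rewrite lee_fin.
have cE0 : (0 <= c%:E)%E by rewrite lee_fin.
apply: eq_le_trans (ge0_integralZl mu measurableT mI I0 cE0) _.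
have IE : (\int[mu]_y (\1_[set y | N y < N x / 2] y)%:E = ((N x / 2) ^+ Q * K)%:E)%E.
  by rewrite integral_indic // setIT; exact: ballN.
rewrite IE -EFinM lee_fin /c.
by rewrite le_eqVlt; apply/orP; left; apply/eqP; field; rewrite expf_neq0 // gt_eqF.
Qed.

(** The damped modular which appears in the lower bound; it increases to the
    modular as [s] decreases to [0]. *)
Definition damped_modular s : \bar R :=
  (\int[mu]_x (Phi `|v x| * far_radius x `^ (- (s * pp)))%:E)%E.
Local Notation J := damped_modular.

Lemma damping_ge0 s x : 0 <= Phi `|v x| * far_radius x `^ (- (s * pp)).
Proof. by rewrite mulr_ge0 ?powR_ge0 // (orlicz_fun_ge0 hphi). Qed.

Lemma measurable_damping s :
  measurable_fun setT (fun x => Phi `|v x| * far_radius x `^ (- (s * pp))).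
Proof.
apply: measurable_funM; first exact: measurable_Phi_v.
by apply: measurable_powR_comp; exact: measurable_far_radius.
Qed.

Lemma damping_antitone s t x : s <= t ->
  Phi `|v x| * far_radius x `^ (- (t * pp)) <=
  Phi `|v x| * far_radius x `^ (- (s * pp)).
Proof.
move=> st; have [_ pp0] := orlicz_exponents_gt0 hphi.
rewrite ler_wpM2l ?(orlicz_fun_ge0 hphi) // ler_powR ?lerN2 ?ler_pM2r //.
by rewrite /far_radius; have := N0 x; lra.
Qed.

Lemma damped_modular_antitone s t : s <= t -> (J t <= J s)%E.
Proof.
move=> st; apply: le_integral_EFin (measurable_damping t) (measurable_damping s) _ _.
- exact: damping_ge0.
- by move=> x; exact: damping_antitone.
Qed.

Lemma damped_modular_ge0 s : (0 <= J s)%E.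
Proof. by apply: integral_ge0 => x _; rewrite lee_fin damping_ge0. Qed.

Lemma damped_modular_le s : 0 <= s -> (J s <= P)%E.
Proof.
move=> s0; apply: le_trans (damped_modular_antitone s0) _.
rewrite le_eqVlt; apply/orP; left; apply/eqP; apply: eq_integral => x _.
by rewrite mul0r oppr0 powRr0 mulr1.
Qed.

Lemma damped_modular_cvg : J k.+1%:R^-1 @[k --> \oo] --> P.
Proof.
have Phi_ge0 := orlicz_fun_ge0 hphi.
pose g k x := (Phi `|v x| * far_radius x `^ (- (k.+1%:R^-1 * pp)))%:E.
have limE x : setT x -> lim (g^~ x @ \oo) = (Phi `|v x|)%:E.
  move=> _; apply/cvg_lim => //; apply/cvg_EFin; first by apply: nearW => k.
  rewrite -[X in _ --> X]mulr1; apply: cvgM; first exact: cvg_cst.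
  have r0 := far_radius_gt0 x.
  rewrite (_ : (fun k => _) =
      fun k => expR (- (k.+1%:R^-1 * pp) * ln (far_radius x))); last first.
    by apply/funext => k; rewrite /powR gt_eqF.
  have H0 : (k.+1%:R^-1 * pp : R) @[k --> \oo] --> 0 * pp.
    by apply: cvgMr_tmp; exact: cvg_harmonic.
  have H1 : (- (k.+1%:R^-1 * pp) * ln (far_radius x) : R) @[k --> \oo]
      --> - (0 * pp) * ln (far_radius x).
    by apply: cvgMr_tmp; exact: cvgN.
  have := continuous_cvg _ (@continuous_expR R _) H1.
  by rewrite mul0r oppr0 mul0r expR0 => /(_ _); exact.
rewrite -(eq_integral _ _ (fun x _ => limE x I)).
apply: cvg_monotone_convergence => //.
- by move=> k; apply/measurable_EFinP; exact: measurable_damping.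
- by move=> k x _; rewrite lee_fin damping_ge0.
- move=> x _ k l kl; rewrite lee_fin; apply: damping_antitone.
  by rewrite lef_pV2 ?posrE // ler_nat.
Qed.

Lemma far_weight_swap_le1 p : far_weight p + far_weight (p.2, p.1) <= 1.
Proof.
rewrite /far_weight !indicE.
case: (boolP (_ \in _)) => [/set_mem H|_]; last by rewrite add0r lern1 leq_b1.
case: (boolP (_ \in _)) => [/set_mem H'|_]; last by rewrite addr0.
have [A _ _] := far_region H; have [/= B _ _] := @far_region (p.2, p.1) H'.
by have := N0 p.1; have := N0 p.2; lra.
Qed.

(** The far region and its mirror image are disjoint, so the symmetric
    integrand is counted twice. *)
Lemma far_integral_twice s :
  (\int[mu \x mu]_p (far_weight p * h s p)%:E +
   \int[mu \x mu]_p (far_weight p * h s p)%:E <= F s)%E.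
Proof.
have mh := measurable_quotient_integrand s.
have h0 := quotient_integrand_ge0 s.
have pointwise p : far_weight p * h s p + far_weight (p.2, p.1) * h s (p.2, p.1) <= h s p.
  rewrite quotient_integrand_sym -mulrDl.
  by rewrite -[leRHS]mul1r ler_wpM2r // far_weight_swap_le1.
have mf : measurable_fun setT (fun p => far_weight p * h s p).
  exact: measurable_funM measurable_far_weight mh.
have f0 p : 0 <= far_weight p * h s p := mulr_ge0 (far_weight_ge0 p) (h0 p).
have mf' : measurable_fun setT (fun p : T * T => far_weight (p.2, p.1) * h s (p.2, p.1)).
  by apply: (measurableT_comp (f := fun p => far_weight p * h s p) mf); exact: measurable_swap.
have f'0 p : 0 <= far_weight (p.2, p.1) * h s (p.2, p.1) := f0 _.
have mfE : measurable_fun setT (fun p => (far_weight p * h s p)%:E).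
  exact/measurable_EFinP.
have fE0 p : (0 <= (far_weight p * h s p)%:E)%E by rewrite lee_fin.
have E := product_integral_swap mfE fE0.
apply: eq_le_trans (congr1 (fun z => _ + z)%E (esym E)) _.
apply: eq_le_trans (esym (integralD_EFin _ mf mf' f0 f'0)) _.
exact: le_integral_EFin _ (measurable_funD mf mf') mh
  (fun p => addr_ge0 (f0 p) (f'0 p)) pointwise.
Qed.

(** [quotient_integrand_lower] bounds the integral over the far region from below,
    and this integral occurs twice in the fractional modular. *)
Lemma fractional_modular_lower s : 0 < s ->
  ((4 / C)%:E * (Q%:R%:E * K%:E * pp^-1%:E) * J s <=
   s%:E * F s + (2 * s * K)%:E * P)%E.
Proof.
move=> s0; have [_ pp0] := orlicz_exponents_gt0 hphi.
have [q q0 PE] := P_EFin.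
have [j j0 JE] : exists2 j, 0 <= j & J s = j%:E.
  exists (fine (J s)); first exact/fine_ge0/damped_modular_ge0.
  rewrite fineK // ge0_fin_numE ?damped_modular_ge0 //.
  exact: le_lt_trans (damped_modular_le (ltW s0)) P_fin.
have C20 : 0 <= 2 / C := divr_ge0 (ler0n R 2) (ltW C0).
pose t p := tail_weight far_radius (s * pp) p * Phi `|v p.2|.
pose f p := far_weight p * h s p.
pose e p := error_weight p * Phi `|v p.1|.
have mt : measurable_fun setT t.
  apply: measurable_funM (measurable_tail_weight _ measurable_far_radius) _.
  exact: measurableT_comp measurable_Phi_v measurable_snd.
have mf : measurable_fun setT f.
  exact: measurable_funM measurable_far_weight (measurable_quotient_integrand s).
have me : measurable_fun setT e.
  apply: measurable_funM measurable_error_weight _.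
  exact: measurableT_comp measurable_Phi_v measurable_fst.
have t0 p : 0 <= t p := mulr_ge0 (tail_weight_ge0 _ _ p) (orlicz_fun_ge0 hphi _).
have f0 p : 0 <= f p := mulr_ge0 (far_weight_ge0 p) (quotient_integrand_ge0 s p).
have e0 p : 0 <= e p := mulr_ge0 (error_weight_ge0 p) (orlicz_fun_ge0 hphi _).
have tE : (\int[mu \x mu]_p (t p)%:E = (Q%:R * K / (s * pp) * j)%:E)%E.
  rewrite (integral_tail_weight (mulr_gt0 s0 pp0) measurable_far_radius
    far_radius_gt0 measurable_Phi_v (fun x => orlicz_fun_ge0 hphi _)).
  by rewrite -/(J s) JE -EFinM.
have eE : (\int[mu \x mu]_p (e p)%:E <= (K * q)%:E)%E.
  by apply: le_trans integral_error_weight _; rewrite PE -EFinM.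
have mct : measurable_fun setT (fun p => 2 / C * t p) by exact: measurable_funM.
have ct0 p : 0 <= 2 / C * t p := mulr_ge0 C20 (t0 p).
have E : ((2 / C)%:E * (Q%:R * K / (s * pp) * j)%:E <=
          \int[mu \x mu]_p (f p)%:E + (K * q)%:E)%E.
  apply: eq_le_trans (congr1 (fun z => _ * z)%E (esym tE)) _.
  apply: eq_le_trans (esym (integralZ_EFin _ C20 mt t0)) _.
  apply: le_trans (le_integral_EFin _ mct (measurable_funD mf me) ct0
    (fun p => quotient_integrand_lower p s0)) _.
  by apply: eq_le_trans (integralD_EFin _ mf me f0 e0) _; exact: leeD2l.
have X0 : (0 <= \int[mu \x mu]_p (f p)%:E)%E.
  by apply: integral_ge0 => p _; rewrite lee_fin.
move: E (far_integral_twice s) X0; rewrite -/f PE JE.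
move: (\int[mu \x mu]_p (f p)%:E)%E (F s) => X Y.
rewrite -!EFinM; case: Y => [y| |]; case: X => [x| |] //.
- rewrite -!EFinM -!EFinD !lee_fin => H1 H2 _.
  have {H1} : 2 / C * (Q%:R * K / (s * pp) * j) * s <= (x + K * q) * s.
    by rewrite ler_wpM2r // ltW.
  have {H2} : (x + x) * s <= y * s by rewrite ler_wpM2r // ltW.
  have -> : 2 / C * (Q%:R * K / (s * pp) * j) * s = 2 / C * (Q%:R * K / pp * j).
    by field; rewrite !gt_eqF.
  rewrite (_ : 4 / C * _ * j = 2 * (2 / C * (Q%:R * K / pp * j))); last by ring.
  by move: (2 / C * _) => z H2 H1; lra.
- by move=> _ _ _; rewrite gt0_muley ?lte_fin // addye // leey.
- by move=> _ _ _; rewrite gt0_muley ?lte_fin // addye // leey.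
Qed.

Lemma fractional_modular_limsup s0 : 0 < s0 -> (F s0 < +oo)%E ->
  (limf_esup (fun s : R => s%:E * F s) 0^'+ <=
   C%:E * (Q%:R%:E * K%:E * pm^-1%:E) * P)%E.
Proof.
move=> s0_gt0 Fs0; have [q q0 PE] := P_EFin.
have [y y0 yE] : exists2 y, 0 <= y & F s0 = y%:E.
  have F0 : (0 <= F s0)%E by apply: integral_ge0 => p _; exact: hE0.
  by exists (fine (F s0)); [exact: fine_ge0|rewrite fineK // ge0_fin_numE].
have y1 : 0 < y + 1 by exact: ltr_wpDl.
(* [s <= e / (y + 1)] makes [s * y] at most [e]. *)
apply/lee_addgt0Pr => e e0; apply: limf_esup_le; near=> s.
have s_gt0 : 0 < s by near: s; exact: nbhs_right_gt.
have ss0 : s <= s0 by near: s; exact: nbhs_right_le.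
have se : s <= e / (y + 1) by near: s; apply: nbhs_right_le; exact: divr_gt0.
apply: le_trans (fractional_modular_upper s_gt0 ss0) _.
rewrite yE addeC; apply: leeD2l; rewrite -EFinM lee_fin.
move: se; rewrite ler_pdivlMr //; apply: le_trans.
by rewrite ler_wpM2l ?(ltW s_gt0) // lerDl.
Unshelve. all: by end_near.
Qed.

Lemma fractional_modular_liminf :
  ((4 / C)%:E * (Q%:R%:E * K%:E * pp^-1%:E) * P <=
   limf_einf (fun s : R => s%:E * F s) 0^'+)%E.
Proof.
have [_ pp0] := orlicz_exponents_gt0 hphi; have [q q0 PE] := P_EFin.
rewrite -!EFinM; set c := (4 / C * _).
have c0 : 0 <= c.
  by rewrite mulr_ge0 ?divr_ge0 ?mulr_ge0 ?invr_ge0 // ltW.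
have cJ : (c%:E * J k.+1%:R^-1)%E @[k --> \oo] --> (c%:E * P)%E.
  by apply: cvgeZl => //; exact: damped_modular_cvg.
apply: (closed_cvg (u_ := fun k => (c%:E * J k.+1%:R^-1)%E)
  (fun y => y <= limf_einf (fun s : R => s%:E * F s) 0^'+)%E _ _ _ cJ).
  exact: closed_ereal_ge_ereal.
(* For fixed [k], every [s] below [k.+1^-1] has a damped modular which is at
   least the one at [k.+1^-1], and the error term tends to [0] with [s]. *)
apply: nearW => k; apply/lee_addgt0Pr => e e0; rewrite -leeBlDr //.
have Kq : 0 <= K * q by exact: mulr_ge0.
have Kq1 : 0 < 2 * (K * q) + 1 by lra.
apply: limf_einf_ge; near=> s.
have s_gt0 : 0 < s by near: s; exact: nbhs_right_gt.
have sk : s <= k.+1%:R^-1 by near: s; apply: nbhs_right_le; rewrite invr_gt0.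
have se : s <= e / (2 * (K * q) + 1).
  by near: s; apply: nbhs_right_le; exact: divr_gt0.
rewrite leeBlDr //.
have cJs : (c%:E * J k.+1%:R^-1 <= c%:E * J s)%E.
  by apply: lee_wpmul2l; rewrite ?lee_fin //; exact: damped_modular_antitone.
apply: (le_trans cJs).
have := fractional_modular_lower s_gt0; rewrite -!EFinM => H.
apply: (le_trans H); apply: leeD2l; rewrite PE -EFinM lee_fin.
move: se; rewrite ler_pdivlMr // => H2.
by apply: le_trans H2; rewrite mulrDr mulr1 !mulrA (mulrC s) ler_wpDr // ltW.
Unshelve. all: by end_near.
Qed.

End metric_measure_estimates.

(** * Borel versions of Lebesgue measurable functions *)

Section almost_everywhere_equal_integrands.
Context d (X : measurableType d) (R : realType) (mu : {measure set X -> \bar R}).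
Import HBNNSimple.

(** No measurability is assumed: a simple function below [f] can be cut down to
    the complement of the null set, where it lies below [g], at no cost. *)
Lemma le_integral_off_null (f g : X -> \bar R) (Z : set X) :
  measurable Z -> mu Z = 0%E -> (forall x, 0 <= f x)%E -> (forall x, 0 <= g x)%E ->
  (forall x, ~ Z x -> f x = g x) -> (\int[mu]_x f x <= \int[mu]_x g x)%E.
Proof.
move=> mZ Z0 f0 g0 fg; rewrite !ge0_integralTE //.
apply/ge_ereal_sup => _ /= [k kf <-].
pose k' := proj_nnsfun k (measurableC mZ).
have k'E : k \_ (~` Z) = k' := mrestrict k (measurableC mZ).
apply: (@le_trans _ _ (sintegral mu k')); last first.
  apply: ereal_sup_ubound; exists k' => // x; rewrite -k'E patchE.
  by case: ifPn => [/set_mem Zx|_]; rewrite ?g0 // -fg.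
rewrite -k'E -integral_nnsfun; last exact: measurableC.
rewrite -[X in sintegral mu X](patch_setT (fun=> 0)) -integral_nnsfun //.
rewrite (ge0_negligible_integral mZ) ?setTD //.
- exact/measurable_EFinP.
- by move=> x _; rewrite lee_fin.
Qed.

Lemma eq_integral_off_null (f g : X -> \bar R) (Z : set X) :
  measurable Z -> mu Z = 0%E -> (forall x, 0 <= f x)%E -> (forall x, 0 <= g x)%E ->
  (forall x, ~ Z x -> f x = g x) -> (\int[mu]_x f x = \int[mu]_x g x)%E.
Proof.
move=> mZ Z0 f0 g0 fg; apply/eqP; rewrite eq_le; apply/andP; split.
  exact: le_integral_off_null mZ Z0 f0 g0 fg.
by apply: le_integral_off_null mZ Z0 g0 f0 _ => x /fg.
Qed.

(** The sets [[q < u]] with [q] rational have Borel versions, whose exceptional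
    sets lie in one null set; setting [u] to [0] there makes it Borel. *)
Lemma borel_version (u : X -> R) :
  (forall B : set (measurableTypeR R), measurable B ->
     completed_algebra_gen mu (u @^-1` B)) ->
  exists (v : X -> R) (Z : set X), [/\ measurable_fun setT v, measurable Z,
    mu Z = 0%E & forall x, ~ Z x -> u x = v x].
Proof.
move=> mu_u.
have split_u (q : rat) : exists p : set X * set X,
    [/\ measurable p.1, mu.-negligible p.2 & u @^-1` `]ratr q, +oo[ = p.1 `|` p.2].
  by have [A mA [S nS AS]] := mu_u _ (@measurable_itv R `]ratr q, +oo[); exists (A, S).
have [AS ASP] := choice split_u.
pose S n := if unpickle n is Some q then (AS q).2 else set0.
have [Z [mZ Z0 SZ]] : mu.-negligible (\bigcup_n S n).
  apply: negligible_bigcup => n; rewrite /S; case: unpickle => [q|].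
    by have [] := ASP q.
  exact: negligible_set0.
have ASZ q x : (AS q).2 x -> Z x.
  have SE : S (pickle q) = (AS q).2 by rewrite /S pickleK.
  rewrite -SE => H; apply: SZ; exact: ex_intro2 _ _ (pickle q) I H.
exists (u \_ (~` Z)), Z; split=> //; last first.
  by move=> x Zx; rewrite patchE mem_set.
apply/(measurable_restrictT u (measurableC mZ)).
move=> mCZ; apply: (measurability _ (RGenOInfty.measurableE R)) => //.
move=> /= _ [_ [a ->] <-]; rewrite preimage_itvoy.
rewrite [X in measurable X](_ : _ =
    \bigcup_(q in [set q : rat | a < ratr q]) (~` Z `&` (AS q).1)).
  rewrite bigcup_mkcond; apply: bigcupT_measurable_rat => q; case: ifPn => // _.
  by apply: measurableI => //; have [] := ASP q.
apply/seteqP; split=> [x [Zx /= ax]|x [q /= aq [Zx Ax]]].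
  have [q] := rat_in_itvoo ax; rewrite inE /= => /itvP h.
  exists q; rewrite /= ?h //; split=> //.
  have [_ _ E] := ASP q; have : (u @^-1` `]ratr q, +oo[) x by rewrite /= in_itv /= h.
  by rewrite E => -[//|/ASZ].
split=> //=; apply: lt_trans aq _; have [_ _ E] := ASP q.
have : (u @^-1` `]ratr q, +oo[) x by rewrite E; left.
by rewrite /= in_itv /= andbT.
Qed.

End almost_everywhere_equal_integrands.

(** * Asymptotics on Carnot groups *)

Section borel_version_of_functionals.
Context {R : realType} {m r : nat} (G : carnot_group R m r).
Context (N : 'rV[R]_(m + r) -> R) (hN : is_homogeneous_norm G N).
Context (phi : R -> R) (pm pp : R) (hphi : is_orlicz phi pm pp).
Local Notation V := 'rV[R]_(m + r).
Local Notation leb := (lebesgue_rV R (m + r)).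
Context (u v : V -> R) (Z : set V) (mZ : measurable Z) (Z0 : leb Z = 0%E).
Hypothesis uv : forall x, ~ Z x -> u x = v x.

Lemma modular_off_null : modular phi u = modular phi v.
Proof.
apply: (eq_integral_off_null mZ Z0) => x.
- by rewrite lee_fin (orlicz_fun_ge0 hphi).
- by rewrite lee_fin (orlicz_fun_ge0 hphi).
- by move=> /uv ->.
Qed.

(** The integrands differ only where one of the two points is in the null set
    [Z], hence off a null set of the product. *)
Lemma frac_modular_off_null s : frac_modular G N phi s u = frac_modular G N phi s v.
Proof.
have m1 : measurable (Z `*` [set: V]) by exact: measurableX.
have m2 : measurable ([set: V] `*` Z) by exact: measurableX.
have Z1 : (leb \x leb)%E (Z `*` [set: V]) = 0%E.
  apply: etrans (product_measure1E _ _ mZ measurableT) _.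
  by rewrite -[RHS](mul0e (leb setT)); congr (_ * _)%E.
have Z2 : (leb \x leb)%E ([set: V] `*` Z) = 0%E.
  apply: etrans (product_measure1E _ _ measurableT mZ) _.
  by rewrite -[RHS](mule0 (leb setT)); congr (_ * _)%E.
have h0 w (p : V * V) : (0 <= (let D := N (cmul G (cinv G p.2) p.1) in
   orlicz_fun phi (`|w p.1 - w p.2| / D `^ s) / D ^+ homogeneous_dim G)%:E)%E.
  by rewrite lee_fin divr_ge0 ?(orlicz_fun_ge0 hphi) // exprn_ge0 // (hnorm_ge0 hN).
apply: (@eq_integral_off_null _ _ _ _ _ _ ((Z `*` [set: V]) `|` ([set: V] `*` Z))) => //.
- exact: measurableU.
- exact: null_set_setU.
- by move=> p /= /not_orP[/not_andP[Z1p|//] /not_andP[//|Z2p]]; rewrite !uv.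
Qed.

End borel_version_of_functionals.

Theorem theorem1p2 (R : realType) (m r : nat) (G : carnot_group R m r)
  (N : 'rV[R]_(m + r) -> R) (hN : is_homogeneous_norm G N)
  (phi : R -> R) (pm pp : R) (hphi : is_orlicz phi pm pp)
  (C : R) (hC : is_delta2_constant phi C)
  (u : 'rV[R]_(m + r) -> R)
  (hu : (\bigcup_(s in `]0, 1[) frac_space G N phi s) u) :
  let Q : R := (homogeneous_dim G)%:R in
  let Cb : \bar R := ball_volume N in
  let lower : \bar R :=
    ((4 / C)%:E * (Q%:E * Cb * (pp^-1)%:E) * modular phi u)%E in
  let upper : \bar R :=
    (C%:E * (Q%:E * Cb * (pm^-1)%:E) * modular phi u)%E in
  let F : R -> \bar R := fun s => (s%:E * frac_modular G N phi s u)%E in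
  [/\ (lower <= limf_einf F 0^'+)%E,
      (limf_einf F 0^'+ <= limf_esup F 0^'+)%E &
      (limf_esup F 0^'+ <= upper)%E] /\
  (forall l : \bar R, F s @[s --> 0^'+] --> l -> (lower <= l <= upper)%E).
Proof.
move=> Q Cb lower upper F.
have [s0 /= s01 [mu_u Pu Fu]] := hu.
have s0_gt0 : 0 < s0 by move: s01; rewrite in_itv /= => /andP[].
have [v [Z [mv mZ Z0 uv]]] := borel_version mu_u.
pose D (p : 'rV[R]_(m + r) * 'rV[R]_(m + r)) := N (cmul G (cinv G p.2) p.1).
have Cb_fin : Cb = (fine Cb)%:E.
  by rewrite fineK // ge0_fin_numE; [exact: (ball_volume_fin hN)|exact: measure_ge0].
have K0 : 0 <= fine Cb by apply: fine_ge0; exact: measure_ge0.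
have mN := measurable_hnorm hN.
have mD := measurable_hnorm_dist hN.
have N0 := hnorm_ge0 hN.
have D0 p : 0 <= D p by exact: N0.
have Dsym x y : D (x, y) = D (y, x) by exact: hnorm_dist_sym.
have Dtri x y : D (x, y) <= N x + N y.
  by have /andP[] := hnorm_triangle hN x y.
have Dtri' x y : N x - N y <= D (x, y).
  by rewrite Dsym; apply: le_trans (ler_norm _) _; have /andP[] := hnorm_triangle hN y x.
have ballN t : 0 < t ->
    lebesgue_rV R (m + r) [set x | N x < t] = (t ^+ homogeneous_dim G * fine Cb)%:E.
  by move=> t0; rewrite (lebesgue_ball0 hN t0) EFinM -Cb_fin.
have ballD y t : 0 < t ->
    lebesgue_rV R (m + r) [set x | D (x, y) < t] = (t ^+ homogeneous_dim G * fine Cb)%:E.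
  by move=> t0; rewrite (lebesgue_ball hN y t0) EFinM -Cb_fin.
have [[C0 doublingC] _] := hC.
have Puv : modular phi u = modular phi v by exact: (modular_off_null hphi mZ Z0 uv).
have Fuv s : frac_modular G N phi s u = frac_modular G N phi s v.
  exact: (frac_modular_off_null hN hphi mZ Z0 uv).
have Pv : (modular phi v < +oo)%E by rewrite -Puv.
have Fv : (frac_modular G N phi s0 v < +oo)%E by rewrite -Fuv.
have FE : F = fun s => (s%:E * frac_modular G N phi s v)%E.
  by apply/funext => s; rewrite /F Fuv.
have lowerP : (lower <= limf_einf F 0^'+)%E.
  rewrite /lower Cb_fin Puv FE.
  exact: (fractional_modular_liminf hphi mN mD N0 D0 Dsym Dtri Dtri' K0 ballN ballD
    C0 doublingC mv Pv).
have upperP : (limf_esup F 0^'+ <= upper)%E.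
  rewrite /upper Cb_fin Puv FE.
  exact: (fractional_modular_limsup hphi mD D0 Dsym K0 ballD C0 doublingC mv Pv s0_gt0 Fv).
split; first by split; [exact: lowerP|exact: limf_einf_le_esup|exact: upperP].
move=> l Fl; apply/andP; split.
  apply: (le_trans lowerP); exact: limf_einf_le_cvg Fl.
apply: le_trans upperP; exact: cvg_le_limf_esup Fl.
Qed.
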